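(* The set of systems $f\in\mathrm{RDS}(I)$ whose unique stationary probability measure $\mu_f$ on $(0,1)$ is singular with respect to Lebesgue measure and has full support in $(0,1)$ is a residual subset of the Baire space $(\mathrm{RDS}(I),d_m)$ (i.e. it contains a dense $G_\delta$ subset of $\mathrm{RDS}(I)$).
   Context: Let $I=[0,1]$. Define $h:(0,1)\to\mathbb{R}$ by $h(x)=\log(x)-\log(1/2)$ for $x\in(0,1/2]$ and $h(x)=\log(1/2)-\log(1-x)$ for $x\in[1/2,1)$, and put $d_h(x,y)=|h(x)-h(y)|$. Let $\mathrm{C}(I)$ be the set of continuous functions $f$ from $I$ onto $I$ such that $f(0)=0$, $f(1)=1$, $f((0,1))\subset(0,1)$, and the (one-sided) derivatives $f'(0),f'(1)$ exist and lie in $(0,\infty)$. It carries the metric $d_{\mathrm{C}(I)}(f,g)=\sup_{x\in(0,1)}d_h(f(x),g(x))$ (which is always finite). Let $\mathrm{RDS}(I)$ be the set of triples $f=(f_0,f_1,p_f)\in\mathrm{C}(I)\times\mathrm{C}(I)\times[0,1]$ such that: (i) $f_0,f_1$ are homeomorphisms; (ii) $f_0(x)<x$ for all $x\in(0,1)$; (iii) $f_1(x)>x$ for all $x\in(0,1)$; (iv) $p_f\in(0,1)$; (v) for $j\in\{0,1\}$, $\Lambda_j=p_f\log f_0'(j)+(1-p_f)\log f_1'(j)>0$. It carries the metric $d_m(f,g)=\max\{d_{\mathrm{C}(I)}(f_0,g_0),d_{\mathrm{C}(I)}(f_1,g_1),|p_f-p_g|\}$. A Borel probability measure $\mu$ on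 $(0,1)$ is stationary for $f\in\mathrm{RDS}(I)$ if $\mu(A)=p_f\,\mu(f_0^{-1}(A))+(1-p_f)\,\mu(f_1^{-1}(A))$ for every Borel set $A\subset(0,1)$. It is a known fact that each $f\in\mathrm{RDS}(I)$ has exactly one stationary Borel probability measure on $(0,1)$, denoted $\mu_f$. A probability measure $\mu$ on $(0,1)$ is singular if there is a Borel set $A$ with $\mu(A)=1$ and Lebesgue measure zero; it has full support if $\mu(U)>0$ for every nonempty open $U\subset(0,1)$. *)

(* Defs.v *)
From HB Require Import structures.
From mathcomp Require Import all_boot all_order all_algebra.
From mathcomp Require Import ring lra.
From mathcomp Require Import all_classical all_reals all_analysis borel_hierarchy.

Set Implicit Arguments.
Unset Strict Implicit.
Unset Printing Implicit Defensive.

Import Order.TTheory GRing.Theory Num.Theory.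
Import numFieldNormedType.Exports.

Local Open Scope classical_set_scope.
Local Open Scope ring_scope.

Section log_distance.
Context {R : realType}.
Implicit Types x y : R.

(* Only meaningful on the open interval (0, 1). *)
Definition hlog x : R :=
  if x <= 2^-1 then ln x - ln 2^-1 else ln 2^-1 - ln (1 - x).

Definition dh x y : R := `|hlog x - hlog y|.

Lemma hlog_lt x y : 0 < x -> y < 1 -> x < y -> hlog x < hlog y.
Proof.
move=> x0 y1 xy; have y0 : 0 < y by lra.
have half0 : 0 < (2^-1 : R) by lra.
rewrite /hlog; case: (leP x) => hx; case: (leP y) => hy; last 2 first.
- lra.
- by rewrite ltrD2l ltrN2 ltr_ln ?posrE; lra.
- by rewrite ltrD2r ltr_ln ?posrE.
- have : ln x <= ln 2^-1 by rewrite ler_ln ?posrE.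
  have : ln (1 - y) < ln 2^-1 by rewrite ltr_ln ?posrE; lra.
  by move=> ? ?; lra.
Qed.

Lemma hlog_le x y : 0 < x -> y < 1 -> x <= y -> hlog x <= hlog y.
Proof.
move=> x0 y1; rewrite le_eqVlt => /predU1P[->//|xy].
exact/ltW/hlog_lt.
Qed.

Lemma hlog_inj x y : 0 < x < 1 -> 0 < y < 1 -> hlog x = hlog y -> x = y.
Proof.
move=> /andP[x0 x1] /andP[y0 y1] hxy; apply/eqP; rewrite eq_le.
apply/andP; split; rewrite leNgt; apply/negP => lt_xy.
- by have := hlog_lt y0 x1 lt_xy; rewrite hxy ltxx.
- by have := hlog_lt x0 y1 lt_xy; rewrite hxy ltxx.
Qed.

Lemma hlog1B x : 0 < x < 1 -> hlog (1 - x) = - hlog x.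
Proof.
move=> x01; rewrite /hlog; case: (leP x) => hx; case: leP => hy.
- by have -> : x = 2^-1 by [lra]; have -> : 1 - 2^-1 = 2^-1 :> R by [lra]; lra.
- have -> : 1 - (1 - x) = x by lra.
  lra.
- lra.
- lra.
Qed.

End log_distance.

Section one_sided_derivatives.
Context {R : realType}.
Implicit Types (f : R -> R) (a : R).

Definition dquot f a (t : R) : R := (f t - f a) / (t - a).

Definition rderivable f a := cvg (dquot f a t @[t --> a^'+]).
Definition rderive f a : R := lim (dquot f a t @[t --> a^'+]).

Definition lderivable f a := cvg (dquot f a t @[t --> a^'-]).
Definition lderive f a : R := lim (dquot f a t @[t --> a^'-]).

End one_sided_derivatives.

(* A map I -> I fixing 0 and 1 is encoded by its extension by the identity    *)
(* outside I = [0, 1]; this makes the encoding injective, and preimages of    *)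
(* subsets of (0, 1) are the same for the map and for its extension.          *)
Record CI (R : realType) := MkCI {
  CI_fun :> R -> R ;
  CI_ext : forall x, ~ `[0, 1]%classic x -> CI_fun x = x ;
  CI_cont : {within `[0, 1], continuous CI_fun} ;
  CI_onto : CI_fun @` `[0, 1] = `[0, 1]%classic ;
  CI_at0 : CI_fun 0 = 0 ;
  CI_at1 : CI_fun 1 = 1 ;
  CI_inner : CI_fun @` `]0, 1[ `<=` `]0, 1[%classic ;
  CI_rderivable0 : rderivable CI_fun 0 ;
  CI_rderive0_gt0 : 0 < rderive CI_fun 0 ;
  CI_lderivable1 : lderivable CI_fun 1 ;
  CI_lderive1_gt0 : 0 < lderive CI_fun 1
}.

HB.instance Definition _ (R : realType) := gen_eqMixin (CI R).
HB.instance Definition _ (R : realType) := gen_choiceMixin (CI R).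

Section CI_metric.
Context {R : realType}.
Implicit Types f g k : CI R.

Definition dC f g : R := sup [set dh (f x) (g x) | x in `]0, 1[%classic].

Lemma CI_in01 f x : 0 < x < 1 -> 0 < f x < 1.
Proof.
move=> x01; have /= := @CI_inner R f (f x); rewrite !in_itv/=; apply.
by exists x => //=; rewrite in_itv.
Qed.

Lemma CI_eq f g : (forall x : R, 0 < x < 1 -> f x = g x) -> f = g.
Proof.
move=> fg; have {fg} : CI_fun f = CI_fun g.
  apply/funext => x; have [/=|x01] := pselect (`[0, 1]%classic x); last first.
    by rewrite !CI_ext.
  rewrite in_itv/= => /andP[]; rewrite le_eqVlt => /predU1P[<-|x0].
    by rewrite !CI_at0.
  rewrite le_eqVlt => /predU1P[->|x1]; first by rewrite !CI_at1.
  by apply: fg; rewrite x0.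
case: f g => [f ? ? ? ? ? ? ? ? ? ?] [g ? ? ? ? ? ? ? ? ? ?]/= fg.
by subst g; f_equal; exact: Prop_irrelevance.
Qed.

Lemma hlog_bounded_near0 (f : R -> R) (a : R) : 0 < a ->
  (forall x : R, 0 < x < 1 -> 0 < f x < 1) ->
  f t / t @[t --> 0^'+] --> a ->
  exists d M : R, [/\ 0 < d, d <= 2^-1 &
    forall t : R, 0 < t < d -> `|hlog (f t) - hlog t| <= M].
Proof.
move=> a0 f01 fa.
have : \forall t \near 0^'+, `|a - f t / t| < a / 2.
  by move/cvgrPdist_lt : fa; apply; lra.
move=> [/= e e0 He].
pose d := Num.min e (Num.min 2^-1 (a * 4)^-1).
have d0 : 0 < d by rewrite !lt_min e0 /= !invr_gt0; apply/andP; split; lra.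
have dh2 : d <= 2^-1 by rewrite !ge_min lexx /= orbT.
have de : d <= e by rewrite ge_min lexx.
have da : d <= (a * 4)^-1 by rewrite !ge_min lexx !orbT.
clearbody d; exists d, (Num.max `|ln (a / 2)| `|ln (a * 2)|); split => // t /andP[t0 td].
have /He/= : ball_ (fun x => `|x|) 0 e t.
  by rewrite /= sub0r normrN gtr0_norm//; exact: lt_le_trans td de.
move=> /(_ t0); rewrite ltr_distlC => /andP[q1 q2].
set q := f t / t in q1 q2.
have ft : f t = q * t by rewrite /q divfK// gt_eqF.
have /andP[f0 f1] : 0 < f t < 1 by apply: f01; lra.
have fh : f t <= 2^-1.
  have : q * t <= (a * 2) * (a * 4)^-1.
    by apply: ler_pM; rewrite ?divr_ge0 //; lra.
  have -> : (a * 2) * (a * 4)^-1 = 2^-1 by field; rewrite gt_eqF.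
  by rewrite -ft.
rewrite /hlog fh ifT; last lra.
have -> : ln (f t) - ln 2^-1 - (ln t - ln 2^-1) = ln q.
  rewrite /q ln_div ?posrE//; lra.
have l1 : ln (a / 2) <= ln q by rewrite ler_ln ?posrE; lra.
have l2 : ln q <= ln (a * 2) by rewrite ler_ln ?posrE; lra.
rewrite le_max; have [q0|q0] := ger0P (ln q).
  by rewrite (le_trans l2 (ler_norm _)) orbT.
by rewrite -normrN (le_trans _ (ler_norm _))// lerN2.
Qed.

Lemma hlog_bounded f :
  exists M : R, forall x : R, 0 < x < 1 -> `|hlog (f x) - hlog x| <= M.
Proof.
have [|||d0 [M0 [d00 d0h H0]]] := @hlog_bounded_near0 f (rderive f 0).
- exact: CI_rderive0_gt0.
- exact: CI_in01.
- have := @CI_rderivable0 R f; rewrite /rderivable /rderive.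
  by under eq_fun do rewrite /dquot CI_at0 !subr0.
pose g x := 1 - f (1 - x).
have g01 x : 0 < x < 1 -> 0 < g x < 1.
  by move=> x01; have := @CI_in01 f (1 - x); rewrite /g; lra.
have [|//||d1 [M1 [d10 d1h H1]]] := @hlog_bounded_near0 g (lderive f 1).
- exact: CI_lderive1_gt0.
- have /cvgrPdist_lt/= Hf := @CI_lderivable1 R f.
  apply/cvgrPdist_lt => /= e e0; have [/= r r0 Hr] := Hf _ e0.
  exists r => //= t; rewrite /= sub0r normrN => tr t0.
  have := Hr (1 - t) => /=; rewrite opprB addrCA subrr addr0.
  move=> /(_ tr); rewrite gtrBl => /(_ t0).
  suff -> : dquot f 1 (1 - t) = g t / t by [].
  by rewrite /dquot CI_at1 /g; field; rewrite gt_eqF//=; apply/eqP; lra.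
have le01 : d0 <= 1 - d1 by lra.
have cf : {within `[d0, 1 - d1], continuous f}.
  apply: continuous_subspaceW (@CI_cont R f) => x /=.
  by rewrite !in_itv/= => /andP[? ?]; lra.
have [c cI cmax] := EVT_max le01 cf.
have [b bI bmin] := EVT_min le01 cf.
have fb : 0 < f b < 1 by apply: CI_in01; move: bI; rewrite in_itv/=; lra.
have fc : 0 < f c < 1 by apply: CI_in01; move: cI; rewrite in_itv/=; lra.
pose K := hlog (f c) - hlog d0; pose L := hlog (1 - d1) - hlog (f b).
exists (Num.max (Num.max M0 M1) (Num.max K L)) => x x01.
rewrite !le_max; have [xd0|xd0] := ltP x d0.
  by rewrite H0//; lra.
have [xd1|xd1] := ltP (1 - d1) x.
  have := H1 (1 - x); rewrite /g opprB addrCA subrr addr0.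
  rewrite !hlog1B//; last exact: CI_in01.
  rewrite -opprD normrN => -> //; first by rewrite orbT.
  lra.
have xI : x \in `[d0, 1 - d1] by rewrite in_itv/= xd0.
have /andP[fx0 fx1] := CI_in01 f x01.
have h1 : hlog (f x) <= hlog (f c) by apply: hlog_le; [lra|lra|exact: cmax].
have h2 : hlog (f b) <= hlog (f x) by apply: hlog_le; [lra|lra|exact: bmin].
have h3 : hlog d0 <= hlog x by apply: hlog_le; lra.
have h4 : hlog x <= hlog (1 - d1) by apply: hlog_le; lra.
have [p|p] := ger0P (hlog (f x) - hlog x).
- by apply/orP; right; apply/orP; left; rewrite /K; lra.
- by apply/orP; right; apply/orP; right; rewrite /L; lra.
Qed.

Lemma dh_ubound f g : has_ubound [set dh (f x) (g x) | x in `]0, 1[%classic].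
Proof.
have [M HM] := hlog_bounded f; have [N HN] := hlog_bounded g.
exists (M + N) => y [x /=]; rewrite in_itv/= => x01 <-.
by rewrite /dh (le_trans (ler_distD (hlog x) _ _))// lerD ?HM// distrC HN.
Qed.

Lemma dh_le_dC f g x : 0 < x < 1 -> dh (f x) (g x) <= dC f g.
Proof.
move=> x01; apply: (ub_le_sup (dh_ubound f g)).
by exists x => //=; rewrite in_itv.
Qed.

Lemma dC_le f g (M : R) :
  (forall x : R, 0 < x < 1 -> dh (f x) (g x) <= M) -> dC f g <= M.
Proof.
move=> H; apply: ge_sup => [|y [x/= + <-]]; last by rewrite in_itv/=; exact: H.
by exists (dh (f 2^-1) (g 2^-1)), 2^-1 => //=; rewrite in_itv/=; lra.
Qed.

Lemma dCxx f : dC f f = 0.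
Proof.
apply/eqP; rewrite eq_le dC_le => [/=|x _]; last by rewrite /dh subrr normr0.
have h01 : 0 < (2^-1 : R) < 1 by lra.
exact: le_trans (normr_ge0 _) (dh_le_dC f f h01).
Qed.

Lemma dC_positivity f g : dC f g = 0 -> f = g.
Proof.
move=> fg; apply: CI_eq => x x01; apply: hlog_inj; rewrite ?CI_in01//.
apply/eqP; rewrite -subr_eq0 -normr_le0.
by have := dh_le_dC f g x01; rewrite fg.
Qed.

Lemma dC_sym f g : dC f g = dC g f.
Proof. by congr (sup _); apply: eq_imagel => x _; exact: distrC. Qed.

Lemma dC_triangle g f k : dC f k <= dC f g + dC g k.
Proof.
apply: dC_le => x x01; rewrite (le_trans (ler_distD (hlog (g x)) _ _))//.
by rewrite lerD// dh_le_dC.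
Qed.

HB.instance Definition _ :=
  isMetric.Build R (CI R) dCxx dC_positivity dC_sym dC_triangle.

End CI_metric.

(* f is continuous by assumption, so only a continuous inverse is required. *)
Definition homeoI (R : realType) (f : CI R) : Prop :=
  exists g : R -> R, [/\ {within `[0, 1], continuous g},
    g @` `[0, 1] `<=` `[0, 1]%classic,
    {in `[0, 1], cancel f g} & {in `[0, 1], cancel g f}].

Record RDS (R : realType) := MkRDS {
  rds0 : CI R ;
  rds1 : CI R ;
  rdsp : R ;
  rds0_homeo : homeoI rds0 ;
  rds1_homeo : homeoI rds1 ;
  rds0_lt : forall x : R, 0 < x < 1 -> rds0 x < x ;
  rds1_gt : forall x : R, 0 < x < 1 -> x < rds1 x ;
  rdsp_in01 : 0 < rdsp < 1 ;
  rds_Lambda0 : 0 < rdsp * ln (rderive rds0 0) + (1 - rdsp) * ln (rderive rds1 0) ;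
  rds_Lambda1 : 0 < rdsp * ln (lderive rds0 1) + (1 - rdsp) * ln (lderive rds1 1)
}.

HB.instance Definition _ (R : realType) := gen_eqMixin (RDS R).
HB.instance Definition _ (R : realType) := gen_choiceMixin (RDS R).

Section RDS_metric.
Context {R : realType}.
Implicit Types f g k : RDS R.

Definition dm f g : R :=
  Num.max (Num.max (dC (rds0 f) (rds0 g)) (dC (rds1 f) (rds1 g)))
          `|rdsp f - rdsp g|.

Lemma RDS_eq f g : rds0 f = rds0 g -> rds1 f = rds1 g -> rdsp f = rdsp g ->
  f = g.
Proof.
case: f g => [f0 f1 p ? ? ? ? ? ? ?] [g0 g1 q ? ? ? ? ? ? ?]/= e0 e1 e2.
by subst g0 g1 q; f_equal; exact: Prop_irrelevance.
Qed.

Lemma dmxx f : dm f f = 0.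
Proof. by rewrite /dm !dCxx subrr normr0 !maxxx. Qed.

Lemma dm_positivity f g : dm f g = 0 -> f = g.
Proof.
move=> fg; have : dm f g <= 0 by rewrite fg.
have dC0 (u v : CI R) : dC u v <= 0 -> u = v.
  move=> uv; apply: dC_positivity; apply/eqP; rewrite eq_le uv.
  exact: (mdist_ge0 (u : CI R) v).
rewrite /dm !ge_max normr_le0 subr_eq0 => /andP[/andP[/dC0 e0 /dC0 e1] /eqP e2].
exact: RDS_eq.
Qed.

Lemma dm_sym f g : dm f g = dm g f.
Proof. by rewrite /dm dC_sym (dC_sym (rds1 f)) distrC. Qed.

Lemma dm_triangle g f k : dm f k <= dm f g + dm g k.
Proof.
rewrite {1}/dm !ge_max -andbA; apply/and3P; split.
- apply: (le_trans (dC_triangle (rds0 g) _ _)).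
  by apply: lerD; rewrite /dm !le_max lexx.
- apply: (le_trans (dC_triangle (rds1 g) _ _)).
  by apply: lerD; rewrite /dm !le_max lexx ?orbT.
- apply: (le_trans (ler_distD (rdsp g) _ _)).
  by apply: lerD; rewrite /dm !le_max lexx ?orbT.
Qed.

HB.instance Definition _ :=
  isMetric.Build R (RDS R) dmxx dm_positivity dm_sym dm_triangle.

End RDS_metric.

Definition baire_space (T : topologicalType) : Prop :=
  forall U : (set T)^nat, (forall n, open (U n) /\ dense (U n)) ->
    dense (\bigcap_n U n).

Definition residual (T : topologicalType) (E : set T) : Prop :=
  exists G : set T, [/\ Gdelta G, dense G & G `<=` E].

Section stationary.
Context {R : realType}.
Implicit Types mu nu : probability (measurableTypeR R) R.

(* A Borel probability measure on (0, 1) is encoded as a Borel probability    *)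
(* measure on R giving mass 1 to (0, 1).                                      *)
Definition on01 mu : Prop := mu `]0, 1[%classic = 1%E.

Definition stationary (f : RDS R) mu : Prop :=
  forall A : set (measurableTypeR R), measurable A -> A `<=` `]0, 1[%classic ->
    mu A = ((rdsp f)%:E * mu (rds0 f @^-1` A) +
            (1 - rdsp f)%:E * mu (rds1 f @^-1` A))%E.

Definition unique_stationary (f : RDS R) mu : Prop :=
  [/\ on01 mu, stationary f mu &
    forall nu, on01 nu -> stationary f nu ->
      forall A : set (measurableTypeR R), measurable A -> nu A = mu A].

Definition singular01 mu : Prop :=
  exists A : set (measurableTypeR R), [/\ measurable A,
    A `<=` `]0, 1[%classic, mu A = 1%E & lebesgue_measure A = 0%E].

Definition full_support01 mu : Prop :=
  forall U : set R, open U -> U !=set0 -> U `<=` `]0, 1[%classic ->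
    (0 < mu U)%E.

End stationary.

(* Main.v *)
Require Import Defs.
From HB Require Import structures.
From mathcomp Require Import all_boot all_order all_algebra.
From mathcomp Require Import ring lra.
From mathcomp Require Import all_classical all_reals all_analysis borel_hierarchy.
From mathcomp Require Import measurable_realfun.

Set Implicit Arguments.
Unset Strict Implicit.
Unset Printing Implicit Defensive.

Import Order.TTheory GRing.Theory Num.Theory.
Import numFieldNormedType.Exports.

Local Open Scope classical_set_scope.
Local Open Scope ring_scope.

(** In the coordinate t = h(x) an element of C(I) becomes a map of the line with
    t |-> phi t - t convergent at both ends, and d_C is the sup distance.
    The distribution function F of a stationary measure is a fixed point of
    T F = p (F \o f_0^-1) + (1 - p) (F \o f_1^-1), with limits 0 and 1 at the ends.
    Since f_0^-1 moves every point towards the right end, a maximum principle holds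
    for T: two such fixed points coincide.  The positive Lyapunov exponents make
    min(1, C x^alpha) a supersolution, uniformly in a neighbourhood of the system;
    the iterates of T on it decrease to F, and the dual iterates increase to F.
    This gives existence, and joint continuity of F in the system and the point.
    Hence [F a < F b] and "mass > 1 - eps in intervals of total length < eps" are
    open conditions on the system, and by Baire it suffices that each is dense.
    For the second one, conjugate the system by a homeomorphism which, inside each
    cell of a fine partition, squeezes most of the mass into a short interval.
    For the first one, make the two maps linear near 0, with slopes whose logarithms
    generate arbitrarily small translations: an interval of mass zero then spreads
    over a neighbourhood of 0, and forces the measure to vanish.
    RDS(I) is a Baire space because limits of nested balls stay in it, as each of its
    countably many strict conditions is protected by a margin on some ball. *)

(** * The logarithmic coordinate *)

Section log_coordinate.
Context {R : realType}.
Implicit Types x y s t : R.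

Definition hexp t : R := if t <= 0 then expR t / 2 else 1 - expR (- t) / 2.

Lemma hexp_in01 t : 0 < hexp t < 1.
Proof.
rewrite /hexp; have [t0|t0] := leP t 0.
  have := expR_gt0 t; have : expR t <= 1 by rewrite expR_le1.
  lra.
have := expR_gt0 (- t); have : expR (- t) < 1 by rewrite expR_lt1; lra.
lra.
Qed.

Lemma hexpK : cancel hexp (@hlog R).
Proof.
move=> t; rewrite /hexp; have [t0|t0] := leP t 0.
  have e1 : expR t <= 1 by rewrite expR_le1.
  rewrite /hlog ifT; last by lra.
  by rewrite lnM ?posrE ?expR_gt0 ?invr_gt0// expRK; lra.
have e1 : expR (- t) < 1 by rewrite expR_lt1; lra.
rewrite /hlog ifF; last by apply/negbTE; rewrite -ltNge; lra.
have -> : 1 - (1 - expR (- t) / 2) = expR (- t) / 2 by lra.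
by rewrite lnM ?posrE ?expR_gt0 ?invr_gt0// expRK; lra.
Qed.

Lemma hlogK x : 0 < x < 1 -> hexp (hlog x) = x.
Proof. by move=> x01; apply: hlog_inj; rewrite ?hexp_in01// hexpK. Qed.

Lemma hlog_ltE x y : 0 < x < 1 -> 0 < y < 1 -> (hlog x < hlog y) = (x < y).
Proof.
move=> /andP[x0 x1] /andP[y0 y1]; apply/idP/idP; last exact: hlog_lt.
by apply: contraTT; rewrite -!leNgt; exact: hlog_le.
Qed.

Lemma hexp_lt s t : (hexp s < hexp t) = (s < t).
Proof. by rewrite -hlog_ltE ?hexp_in01// !hexpK. Qed.

Lemma hexp_le s t : (hexp s <= hexp t) = (s <= t).
Proof. by rewrite !leNgt hexp_lt. Qed.

Lemma hexpN t : hexp (- t) = 1 - hexp t.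
Proof.
apply: hlog_inj; [exact: hexp_in01| |].
  by have := hexp_in01 t; lra.
by rewrite hexpK hlog1B ?hexp_in01// hexpK.
Qed.

Let hexpB_le0 s t : s <= t -> t <= 0 -> hexp t - hexp s <= (t - s) / 2.
Proof.
move=> st t0; rewrite /hexp t0 ifT; last by lra.
have := expR_ge1Dx (s - t).
have -> : expR s = expR t * expR (s - t) by rewrite -expRD; congr expR; lra.
have := expR_gt0 t; have : expR t <= 1 by rewrite expR_le1.
nra.
Qed.

(** Bounds Lebesgue measure in (0,1) by length in the coordinate t. On the negative half-line the
    slope is at most 1/2, because 1 + u <= exp u; [hexpN] reflects this to the positive one. *)
Lemma hexpB_le s t : s <= t -> hexp t - hexp s <= t - s.
Proof.
move=> st; have [t0|t0] := leP t 0.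
  by have := hexpB_le0 st t0; lra.
have tN : - t <= 0 by lra.
have [s0|s0] := leP s 0.
  have := hexpB_le0 s0 (lexx _); have := hexpB_le0 tN (lexx _).
  have := hexpN (0 : R); rewrite oppr0 => h0; by rewrite hexpN; lra.
have st' : - t <= - s by lra.
have sN : - s <= 0 by lra.
by have := hexpB_le0 st' sN; rewrite !hexpN; lra.
Qed.

End log_coordinate.

(** * Increasing bijections of the line *)

Section increasing_bijections.
Context {R : realType}.
Implicit Types (phi psi : R -> R).

(** Increasing homeomorphisms of the line described by order alone: continuity and the inverse are
    derived from it, so constructions only have to check order and surjectivity. *)
Definition incr_onto phi := {homo phi : s t / s < t} /\ forall y, exists x, phi x = y.

Lemma incr_onto_lt phi : incr_onto phi -> {mono phi : s t / s < t}.
Proof.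
move=> [inc _] s t; apply/idP/idP; last exact: inc.
apply: contraTT; rewrite -!leNgt le_eqVlt => /predU1P[->//|/inc/ltW//].
Qed.

Lemma incr_onto_le phi : incr_onto phi -> {mono phi : s t / s <= t}.
Proof. by move=> /incr_onto_lt h s t; rewrite !leNgt h. Qed.

Lemma incr_onto_inj phi : incr_onto phi -> injective phi.
Proof.
by move=> h s t st; apply/le_anti; rewrite -(incr_onto_le h s) -(incr_onto_le h t) st lexx.
Qed.

Definition rinv phi (y : R) : R := xget 0 [set x | phi x = y].

Lemma rinvK phi : incr_onto phi -> cancel (rinv phi) phi.
Proof.
move=> [_ onto] y; rewrite /rinv; case: xgetP => // h; have [x xy] := onto y.
by have := h x.
Qed.

Lemma Krinv phi : incr_onto phi -> cancel phi (rinv phi).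
Proof. by move=> h x; apply: (incr_onto_inj h); rewrite rinvK. Qed.

Lemma incr_onto_rinv phi : incr_onto phi -> incr_onto (rinv phi).
Proof.
move=> h; split; last by move=> y; exists (phi y); rewrite Krinv.
by move=> s t st; rewrite -(incr_onto_lt h) !rinvK.
Qed.

Lemma incr_onto_comp phi psi : incr_onto phi -> incr_onto psi ->
  incr_onto (phi \o psi).
Proof.
move=> hphi hpsi; split => [s t st|y] /=.
  by rewrite (incr_onto_lt hphi) (incr_onto_lt hpsi).
by exists (rinv psi (rinv phi y)); rewrite !rinvK.
Qed.

Lemma incr_onto_continuous phi : incr_onto phi -> continuous phi.
Proof.
move=> h x; apply/cvgrPdist_le => /= e e0.
pose a := rinv phi (phi x - e); pose b := rinv phi (phi x + e).
have ax : a < x by rewrite -(incr_onto_lt h) /a rinvK//; lra.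
have xb : x < b by rewrite -(incr_onto_lt h) /b rinvK//; lra.
near=> y.
have ay : a < y by near: y; exact: lt_nbhsr.
have yb : y < b by near: y; exact: lt_nbhsl.
have : phi a < phi y by rewrite (incr_onto_lt h).
have : phi y < phi b by rewrite (incr_onto_lt h).
by rewrite /a /b !rinvK// ler_distl; lra.
Unshelve. all: by end_near. Qed.

(* A monotone function with dense range has no jump. *)
Lemma incr_onto_approx phi : {homo phi : s t / s < t} ->
  (forall y e, 0 < e -> exists x, `|phi x - y| <= e) -> incr_onto phi.
Proof.
move=> inc app; split=> // y.
have le := ltW_homo inc.
(* The candidate preimage of y is sup S. If phi (sup S) differed from y, some phi w would fall
   strictly between the two values, and w could lie on neither side of sup S. *)
pose S := [set z | phi z <= y].
have supS : has_sup S.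
  have [z hz] := app (y - 1) 1 ltr01; have [w hw] := app (y + 2) 1 ltr01.
  split; first by exists z; rewrite /S/=; move: hz; rewrite ler_distl; lra.
  exists w => v; rewrite /S/= => vy; rewrite leNgt; apply/negP => /inc.
  by move: hw; rewrite ler_distl; lra.
have above z : sup S < z -> y < phi z.
  move=> zS; rewrite ltNge; apply/negP => h.
  by move: zS; rewrite ltNge => /negP; apply; exact: ub_le_sup (supS.2) _ h.
have below z : z < sup S -> phi z <= y.
  move=> zS; have [|w Sw] := @sup_adherent _ S (sup S - z) _ supS; first lra.
  by rewrite opprB addrC subrK => /inc/ltW/le_trans; apply.
exists (sup S); apply/eqP; rewrite eq_le; apply/andP; split; rewrite leNgt.
- apply/negP => h; pose e := (phi (sup S) - y) / 4.
  have [|w] := app (y + e * 2) e; first by rewrite /e; lra.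
  rewrite ler_distl => hw.
  have [ws|sw] := ltP w (sup S).
    by have := below _ ws; rewrite /e in hw; lra.
  have := le _ _ sw; rewrite /e in hw; lra.
- apply/negP => h; pose e := (y - phi (sup S)) / 4.
  have [|w] := app (y - e * 2) e; first by rewrite /e; lra.
  rewrite ler_distl => hw.
  have [sw|ws] := ltP (sup S) w.
    by have := above _ sw; rewrite /e in hw; lra.
  by have := le _ _ ws; rewrite /e in hw; lra.
Qed.

(** If the orbit were bounded, its supremum s would exceed [rinv phi s]; an orbit point beyond
    [rinv phi s] then has its image beyond s. *)
Lemma iter_gt_unbounded phi : incr_onto phi -> (forall t, t < phi t) ->
  forall a b, exists k, b <= iter k phi a.
Proof.
move=> h gt a b; apply: contrapT => /forallNP nb.
have lb k : iter k phi a < b by rewrite ltNge; apply/negP/nb.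
pose S := range (fun k => iter k phi a).
have supS : has_sup S.
  by split; [exists a, 0 | exists b => _ [k _ <-]; exact/ltW/lb].
have := gt (rinv phi (sup S)); rewrite rinvK// => lt1.
have [|_ [k _ <-]] := @sup_adherent _ S (sup S - rinv phi (sup S)) _ supS; first lra.
rewrite opprB addrC subrK -(incr_onto_lt h) rinvK// => lt2.
have : iter k.+1 phi a <= sup S by apply: (ub_le_sup supS.2); exists k.+1.
by rewrite /=; lra.
Qed.

(** Only s is confined to the segment; t may leave it, so perturbed points can be compared up to the
    ends. Compactness enters as a near covering, with d tending to 0 from the right. *)
Lemma segment_unif_continuous (u : R -> R) (a b e : R) : continuous u -> 0 < e ->
  exists2 d, 0 < d & forall s t, a <= s <= b -> `|s - t| <= d -> `|u s - u t| <= e.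
Proof.
move=> cu e0.
have := @segment_compact R a b => /compact_near_coveringP/(_ R (0^'+)).
pose P (d s : R) := forall t, `|s - t| <= d -> `|u s - u t| <= e.
move=> /(_ P _) [|d /= d0 hd].
- move=> s _; have /cvgrPdist_le/(_ (e / 2)) := cu s.
  move=> [|d /= d0 hd]; first lra.
  exists (ball s (d / 2), [set d' | d' < d / 2]); first split => /=.
  + by apply: nbhsx_ballx; lra.
  + by apply: nbhs_right_lt; lra.
  + move=> [s' d'] [/= bs dd] t td.
    have h1 : `|u s - u s'| <= e / 2 by apply: hd; apply: le_ball bs; lra.
    have h2 : `|u s - u t| <= e / 2.
      apply: hd => /=; move: bs; rewrite /ball/= => bs.
      by have := ler_distD s' s t; lra.
    by have := ler_distD (u s) (u s') (u t); rewrite (distrC (u s') (u s)); lra.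
exists (d / 2); first lra.
move=> s t sab st; apply: (hd (d / 2)) => //=; last lra.
by rewrite sub0r normrN gtr0_norm; lra.
Qed.

End increasing_bijections.

(** * Lifts to the real line *)

Section lifts.
Context {R : realType}.
Implicit Types (phi k : R -> R) (c : CI R).

(** A one-sided derivative in the coordinate t: for a lifted map, A is the logarithm of the
    derivative at 0. The other end is reached through [flip], the conjugation by t -> -t. *)
Definition tail phi (A : R) := forall e, 0 < e ->
  exists K, forall t, t <= K -> `|phi t - t - A| <= e.

Definition flip phi (t : R) := - phi (- t).

Definition lift_of k (t : R) := hlog (k (hexp t)).

Lemma hlogB_le_half (x y : R) : 0 < x <= 2^-1 -> 0 < y <= 2^-1 ->
  hlog y - hlog x = ln (y / x).
Proof.
move=> /andP[x0 xh] /andP[y0 yh]; rewrite /hlog xh yh ln_div ?posrE//; lra.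
Qed.

Lemma hexp0 : hexp 0 = 2^-1 :> R.
Proof. by rewrite /hexp lexx expR0 mul1r. Qed.

Lemma tail_of_cvg k (a : R) : 0 < a -> (forall x : R, 0 < x < 1 -> 0 < k x < 1) ->
  k t / t @[t --> 0^'+] --> a -> tail (lift_of k) (ln a).
Proof.
move=> a0 k01 ka e e0.
have ln_a : ln (k t / t) @[t --> 0^'+] --> ln a.
  by apply: continuous_cvg ka; exact: continuous_ln.
(* With k t / t < 2a, the bound t <= 1/(4a) gives k t <= 1/2, so t and k t lie on the same branch of
   [hlog], where the displacement is ln (k t / t). *)
have : \forall t \near 0^'+, [/\ t <= (4 * a)^-1, t <= 2^-1, k t / t < 2 * a &
    `|ln a - ln (k t / t)| <= e].
  near=> t; split.
  - by near: t; apply: nbhs_right_le; rewrite invr_gt0; lra.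
  - by near: t; apply: nbhs_right_le; lra.
  - by near: t; apply: (cvgr_lt _ ka); lra.
  - by near: t; move/cvgrPdist_le : ln_a; exact.
move=> [d /= d0 hd].
pose d' := Num.min d 1 / 2.
have d'0 : 0 < d' by rewrite /d' divr_gt0// lt_min d0 ltr01.
have m1 : Num.min d 1 <= d by rewrite ge_min lexx.
have m2 : Num.min d 1 <= 1 by rewrite ge_min lexx orbT.
have [d'd d'1] : d' < d /\ d' < 1 by rewrite /d'; lra.
exists (hlog d') => s sd.
have /andP[t0 t1] := hexp_in01 s.
have td : hexp s <= d' by rewrite -[d']hlogK ?hexp_le// d'0.
have [] := hd (hexp s) _ t0.
  by rewrite /= sub0r normrN gtr0_norm//; lra.
move=> ta th kta kl.
have /andP[k0 k1] := k01 _ (hexp_in01 s).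
have kE : k (hexp s) = (k (hexp s) / hexp s) * hexp s by rewrite divfK// gt_eqF.
have kh : k (hexp s) <= 2^-1.
  rewrite kE (le_trans (ler_pM _ _ (ltW kta) ta))//.
  - by rewrite divr_ge0// ltW.
  - exact: ltW.
  - by rewrite le_eqVlt; apply/orP; left; apply/eqP; field; rewrite gt_eqF.
rewrite /lift_of -[X in _ - X - _]hexpK hlogB_le_half ?t0 ?k0//.
by rewrite distrC.
Unshelve. all: by end_near. Qed.

Lemma cvg_of_tail k (A : R) : (forall x : R, 0 < x < 1 -> 0 < k x < 1) ->
  tail (lift_of k) A -> k t / t @[t --> 0^'+] --> expR A.
Proof.
move=> k01 tA.
have [K1 hK1] := tA 1 ltr01.
have small K : \forall t \near (0 : R)^'+, [/\ 0 < t, t < 1, t <= 2^-1 & hlog t <= K].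
  have /andP[K0 K01] := hexp_in01 K.
  near=> t; have t0 : 0 < t by near: t; exact: nbhs_right_gt.
  have t1 : t < 1 by near: t; exact: nbhs_right_lt.
  split=> //; first by near: t; apply: nbhs_right_le; lra.
  rewrite -hexp_le hlogK ?t0//; near: t; exact: nbhs_right_le.
have half K : \forall t \near (0 : R)^'+, 0 < t < 1 /\ hlog t <= K /\
   ln (k t / t) = lift_of k (hlog t) - hlog t.
  (* Below -A - 1 the displacement bound with error 1 makes the lifted image nonpositive, that is k
     t <= 1/2. *)
  have := small (Num.min K (Num.min K1 (- A - 1))); apply: filterS => t.
  rewrite !le_min => -[t0 t1 th /and3P[tK tK1 tA1]]; rewrite t0 t1; split=> //.
  split=> //; rewrite /lift_of hlogK ?t0//.
  have /andP[k0 k1] : 0 < k t < 1 by apply: k01; rewrite t0.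
  rewrite hlogB_le_half ?t0 ?k0//.
  have := hK1 _ tK1; rewrite /lift_of hlogK ?t0// ler_distl => /andP[_ h].
  by rewrite -hexp0 -[k t]hlogK ?k0// hexp_le; lra.
have lnA : ln (k t / t) @[t --> 0^'+] --> A.
  apply/cvgrPdist_le => /= e e0; have [K hK] := tA e e0.
  by apply: filterS (half K) => t [t01 [tK ->]]; rewrite distrC hK.
have cE : expR (ln (k t / t)) @[t --> 0^'+] --> expR A.
  by apply: continuous_cvg lnA; exact: continuous_expR.
suff e : \forall t \near 0^'+, expR (ln (k t / t)) = k t / t.
  exact: cvg_trans (near_eq_cvg e) cE.
apply: filterS (half 0) => t [/andP[t0 t1] _]; rewrite lnK// posrE divr_gt0//.
by have := k01 t; rewrite t0 => /(_ t1)/andP[].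
Unshelve. all: by end_near. Qed.

Lemma cvg_dquot1 k (a : R) : k 1 = 1 ->
  (dquot k 1 t @[t --> 1^'-] --> a) <->
  ((1 - k (1 - t)) / t @[t --> 0^'+] --> a).
Proof.
move=> k1; have E (t : R) : 0 < t -> dquot k 1 (1 - t) = (1 - k (1 - t)) / t.
  by move=> t0; rewrite /dquot k1; field; rewrite gt_eqF//=; apply/eqP; lra.
split=> /cvgrPdist_le/= h; apply/cvgrPdist_le => /= e e0;
  have [/= r r0 hr] := h _ e0; exists r => //= t /= tr t0.
- rewrite -E//; apply: hr => /=; last by lra.
  by move: tr; rewrite sub0r normrN opprB addrCA subrr addr0.
- have := hr (1 - t); rewrite /= sub0r normrN => /(_ tr).
  have t1 : 0 < 1 - t by lra.
  by move=> /(_ t1); rewrite -E// opprB addrCA subrr addr0.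
Qed.

(** A continuous injection of the segment with c 0 <= c 1 is increasing there; the extension by the
    identity makes c an increasing bijection of the whole line. *)
Lemma CI_incr c : homeoI c -> incr_onto c.
Proof.
move=> [g [_ gI cg gc]].
have le01 : (c : R -> R) 0 <= (c : R -> R) 1 by rewrite CI_at0 CI_at1.
have inj : {in `[0, 1] &, injective c}.
  by move=> x y xI yI xy; rewrite -(cg x)// -(cg y)// xy.
have mono := segment_continuous_inj_le le01 (@CI_cont R c) inj.
have out (x : R) : ~~ (0 < x < 1) -> c x = x.
  have [->|x0] := eqVneq x 0; first by rewrite CI_at0.
  have [->|x1] := eqVneq x 1; first by rewrite CI_at1.
  move=> nx; apply: CI_ext => /=; rewrite in_itv/= => /andP[x0' x1'].
  by move/negP : nx; apply; rewrite !lt_neqAle x0' x1' x1 eq_sym x0.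
split.
- move=> s t st; have [s01|s01] := boolP (0 < s < 1).
    have [t01|t01] := boolP (0 < t < 1); last first.
      by rewrite (out t)//; have := CI_in01 c s01; lra.
    have sI : s \in `[0, 1] by rewrite in_itv/=; lra.
    have tI : t \in `[0, 1] by rewrite in_itv/=; lra.
    by rewrite ltNge mono// -ltNge.
  rewrite (out s)//; have [t01|t01] := boolP (0 < t < 1); last by rewrite out.
  by have := CI_in01 c t01; lra.
- move=> y; have [y01|y01] := boolP (0 < y < 1); last by exists y; exact: out.
  by exists (g y); apply: gc; rewrite in_itv/=; lra.
Qed.

Lemma lift_incr c : homeoI c -> incr_onto (lift_of c).
Proof.
move=> /CI_incr h; split=> [s t st|y].
  by rewrite /lift_of hlog_ltE ?CI_in01 ?hexp_in01// (incr_onto_lt h) hexp_lt.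
exists (hlog (rinv c (hexp y))); rewrite /lift_of hlogK ?rinvK ?hexpK//.
have /andP[y0 y1] := hexp_in01 y.
apply/andP; split; rewrite -(incr_onto_lt h) rinvK//.
  by rewrite CI_at0.
by rewrite CI_at1.
Qed.

Lemma lift_tail0 c : tail (lift_of c) (ln (rderive c 0)).
Proof.
apply: tail_of_cvg; [exact: CI_rderive0_gt0|exact: CI_in01|].
have := @CI_rderivable0 R c; rewrite /rderivable /rderive.
by under eq_fun do rewrite /dquot CI_at0 !subr0.
Qed.

Lemma flip_lift (k : R -> R) : (forall x : R, 0 < x < 1 -> 0 < k x < 1) ->
  lift_of (fun x => 1 - k (1 - x)) = flip (lift_of k).
Proof.
move=> k01; apply/funext => t; rewrite /flip /lift_of hexpN -hlog1B//.
by apply: k01; have := hexp_in01 t; lra.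
Qed.

Lemma lift_tail1 c : tail (flip (lift_of c)) (ln (lderive c 1)).
Proof.
rewrite -flip_lift; last exact: CI_in01.
apply: tail_of_cvg; first exact: CI_lderive1_gt0.
  by move=> x x01; have := @CI_in01 _ c (1 - x); lra.
by apply/cvg_dquot1; [exact: CI_at1|exact: CI_lderivable1].
Qed.

Definition unlift phi (x : R) : R :=
  if 0 < x < 1 then hexp (phi (hlog x)) else x.

Lemma unlift_in01 phi x : 0 < x < 1 -> 0 < unlift phi x < 1.
Proof. by move=> x01; rewrite /unlift x01 hexp_in01. Qed.

Lemma unlift_out phi x : ~~ (0 < x < 1) -> unlift phi x = x.
Proof. by move=> /negbTE x01; rewrite /unlift x01. Qed.

Lemma unlift0 phi : unlift phi 0 = 0.
Proof. by rewrite unlift_out ?ltxx. Qed.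

Lemma unlift1 phi : unlift phi 1 = 1.
Proof. by rewrite unlift_out// ltxx andbF. Qed.

Lemma unliftK phi : lift_of (unlift phi) = phi.
Proof.
by apply/funext => t; rewrite /lift_of /unlift hexp_in01 !hexpK.
Qed.

Lemma unlift_can phi psi : cancel phi psi -> cancel (unlift phi) (unlift psi).
Proof.
move=> phiK x; have [x01|x01] := boolP (0 < x < 1).
  by rewrite {1}/unlift unlift_in01//= /unlift x01 hexpK phiK hlogK.
by rewrite !(unlift_out _ x01).
Qed.

Lemma unlift_incr phi : incr_onto phi -> incr_onto (unlift phi).
Proof.
move=> h; split => [s t st|y]; last first.
  by exists (unlift (rinv phi) y); apply: unlift_can; exact: rinvK.
have [s01|s01] := boolP (0 < s < 1).
  have [t01|t01] := boolP (0 < t < 1); last first.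
    by rewrite (unlift_out _ t01); have := unlift_in01 phi s01; lra.
  by rewrite /unlift s01 t01 hexp_lt (incr_onto_lt h) hlog_ltE.
rewrite (unlift_out _ s01); have [t01|t01] := boolP (0 < t < 1).
  by have := unlift_in01 phi t01; lra.
by rewrite unlift_out.
Qed.

Lemma unlift_segment phi : incr_onto phi ->
  unlift phi @` `[0, 1] `<=` `[0, 1]%classic.
Proof.
move=> /unlift_incr h _ [x /= + <-]; rewrite !in_itv/= => /andP[x0 x1].
apply/andP; split; first by rewrite -(unlift0 phi) (incr_onto_le h).
by rewrite -[leRHS](unlift1 phi) (incr_onto_le h).
Qed.

(** Maps are built on the line, where only order, surjectivity and the two limit displacements need
    checking. The derivatives are recorded so that the Lyapunov conditions can be verified. *)
Lemma CI_of_lift phi (A B : R) : incr_onto phi -> tail phi A -> tail (flip phi) B ->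
  exists c : CI R, [/\ homeoI c, lift_of c = phi,
    rderive c 0 = expR A & lderive c 1 = expR B].
Proof.
move=> h tA tB; pose c := unlift phi.
have hc : incr_onto c by exact: unlift_incr.
have cont (psi : R -> R) : incr_onto psi -> {within `[0, 1], continuous psi}.
  by move=> hpsi; apply: continuous_subspaceT; exact: incr_onto_continuous.
have r0 : dquot c 0 t @[t --> 0^'+] --> expR A.
  rewrite /dquot /c unlift0; under eq_fun do rewrite !subr0.
  by apply: cvg_of_tail; [exact: unlift_in01|rewrite unliftK].
have l1 : dquot c 1 t @[t --> 1^'-] --> expR B.
  apply/cvg_dquot1; first exact: unlift1.
  apply: (@cvg_of_tail (fun x => 1 - c (1 - x))).
    by move=> x x01; have := @unlift_in01 phi (1 - x); rewrite /c; lra.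
  by rewrite flip_lift ?unliftK//; exact: unlift_in01.
have rE : rderive c 0 = expR A by exact/cvg_lim.
have lE : lderive c 1 = expR B by exact/cvg_lim.
have ext x : ~ `[0, 1]%classic x -> c x = x.
  move=> /= x01; apply: unlift_out; apply/negP => /andP[x0 x1]; apply: x01.
  by rewrite in_itv/= !ltW.
have onto : c @` `[0, 1] = `[0, 1]%classic.
  apply/seteqP; split; first exact: unlift_segment.
  move=> y /= yI; exists (unlift (rinv phi) y); last exact/unlift_can/rinvK.
  by apply: (unlift_segment (incr_onto_rinv h)); exists y.
have inner : c @` `]0, 1[ `<=` `]0, 1[%classic.
  by move=> _ [x /= + <-]; rewrite !in_itv/=; exact: unlift_in01.
have rpos : 0 < rderive c 0 by rewrite rE expR_gt0.
have lpos : 0 < lderive c 1 by rewrite lE expR_gt0.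
have rd : rderivable c 0 by apply/cvg_ex; exists (expR A).
have ld : lderivable c 1 by apply/cvg_ex; exists (expR B).
exists (MkCI ext (cont _ hc) onto (unlift0 _) (unlift1 _) inner rd rpos ld lpos).
split => //=; last exact: unliftK.
exists (unlift (rinv phi)); split.
- by apply: cont; apply: unlift_incr; exact: incr_onto_rinv.
- by apply: unlift_segment; exact: incr_onto_rinv.
- by move=> x _; apply: unlift_can; exact: Krinv.
- by move=> x _; apply: unlift_can; exact: rinvK.
Qed.

End lifts.

(** * Systems on the line and the maximum principle *)

Section rds_lifts.
Context {R : realType}.
Implicit Types (f g h : RDS R) (j : bool) (t : R).

Definition rdsf f j : CI R := if j then rds1 f else rds0 f.
Definition L f j : R -> R := lift_of (rdsf f j).
Definition G f j : R -> R := rinv (L f j).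
Definition tail0 f j : R := ln (rderive (rdsf f j) 0).
Definition tail1 f j : R := ln (lderive (rdsf f j) 1).

Lemma rdsf_homeo f j : homeoI (rdsf f j).
Proof. by case: j; [exact: rds1_homeo|exact: rds0_homeo]. Qed.

Lemma L_incr f j : incr_onto (L f j).
Proof. exact/lift_incr/rdsf_homeo. Qed.

Lemma L_tail0 f j : tail (L f j) (tail0 f j).
Proof. exact: lift_tail0. Qed.

Lemma L_tail1 f j : tail (flip (L f j)) (tail1 f j).
Proof. exact: lift_tail1. Qed.

Lemma L_lt f t : L f false t < t.
Proof.
have := @rds0_lt _ f _ (hexp_in01 t).
by rewrite -hlog_ltE ?CI_in01 ?hexp_in01// hexpK.
Qed.

Lemma L_gt f t : t < L f true t.
Proof.
have := @rds1_gt _ f _ (hexp_in01 t).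
by rewrite -hlog_ltE ?CI_in01 ?hexp_in01// hexpK.
Qed.

Lemma L_drift0 f : 0 < rdsp f * tail0 f false + (1 - rdsp f) * tail0 f true.
Proof. exact: rds_Lambda0. Qed.

Lemma L_drift1 f : 0 < rdsp f * tail1 f false + (1 - rdsp f) * tail1 f true.
Proof. exact: rds_Lambda1. Qed.

(** The single entry point for new systems: it serves the perturbations linear at an end, the
    conjugates and the limits of nested balls. *)
Lemma RDS_of_lift (phi : bool -> R -> R) (A B : bool -> R) (p : R) :
  (forall j, incr_onto (phi j)) -> (forall j, tail (phi j) (A j)) ->
  (forall j, tail (flip (phi j)) (B j)) ->
  (forall t, phi false t < t) -> (forall t, t < phi true t) -> 0 < p < 1 ->
  0 < p * A false + (1 - p) * A true -> 0 < p * B false + (1 - p) * B true ->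
  exists f : RDS R, (forall j, L f j = phi j) /\ rdsp f = p.
Proof.
move=> inc tA tB lt gt p01 LA LB.
have [c0 [h0 l0 r0 d0]] := CI_of_lift (inc false) (tA false) (tB false).
have [c1 [h1 l1 r1 d1]] := CI_of_lift (inc true) (tA true) (tB true).
have lt0 x : 0 < x < 1 -> c0 x < x.
  move=> x01; have := lt (hlog x).
  by rewrite -l0 /lift_of hlogK// hlog_ltE ?CI_in01.
have gt1 x : 0 < x < 1 -> x < c1 x.
  move=> x01; have := gt (hlog x).
  by rewrite -l1 /lift_of hlogK// hlog_ltE ?CI_in01.
have La : 0 < p * ln (rderive c0 0) + (1 - p) * ln (rderive c1 0).
  by rewrite r0 r1 !expRK.
have Lb : 0 < p * ln (lderive c0 1) + (1 - p) * ln (lderive c1 1).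
  by rewrite d0 d1 !expRK.
by exists (MkRDS h0 h1 lt0 gt1 p01 La Lb); split => //; case.
Qed.

Lemma L_dist f g j t : `|L f j t - L g j t| <= dm f g.
Proof.
apply: (le_trans (dh_le_dC _ _ (hexp_in01 t))).
by rewrite /dm !le_max; case: j; rewrite lexx ?orbT.
Qed.

Lemma rdsp_dist f g : `|rdsp f - rdsp g| <= dm f g.
Proof. by rewrite /dm !le_max lexx orbT. Qed.

Lemma dm_le f g (r : R) : (forall j t, `|L f j t - L g j t| <= r) ->
  `|rdsp f - rdsp g| <= r -> dm f g <= r.
Proof.
move=> hL hp; rewrite /dm !ge_max hp andbT; apply/andP; split; apply: dC_le => x x01.
- by have := hL false (hlog x); rewrite /L /lift_of hlogK.
- by have := hL true (hlog x); rewrite /L /lift_of hlogK.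
Qed.

Lemma near_dm f (e : R) : 0 < e -> \forall g \near f, dm f g < e.
Proof. exact: nbhsx_ballx. Qed.

Lemma open_dm (U : set (RDS R)) f : open U -> U f ->
  exists2 e, 0 < e & forall g, dm f g < e -> U g.
Proof.
rewrite openE => /[apply]; rewrite /interior => /nbhs_ballP[e /= e0 he].
by exists e => // g; exact: he.
Qed.

(** Limit displacements, hence the logarithms of the end derivatives, are 1-Lipschitz in the system,
    so they converge along Cauchy sequences. *)
Lemma tail_dist (phi psi : R -> R) (A B r : R) : tail phi A -> tail psi B ->
  (forall t, `|phi t - psi t| <= r) -> `|A - B| <= r.
Proof.
move=> tA tB d; apply/ler_addgt0Pr => e e0.
have e20 : 0 < e / 2 by lra.
have [K hK] := tA _ e20; have [K' hK'] := tB _ e20.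
pose t := Num.min K K'.
have := hK t; have := hK' t; rewrite !ge_min !lexx orbT => /(_ isT) + /(_ isT).
have := d t; rewrite !ler_distl => *; lra.
Qed.

Lemma LK f j : cancel (L f j) (G f j). Proof. exact/Krinv/L_incr. Qed.
Lemma GK f j : cancel (G f j) (L f j). Proof. exact/rinvK/L_incr. Qed.

Lemma G_incr f j : incr_onto (G f j).
Proof. exact/incr_onto_rinv/L_incr. Qed.

Lemma G_gt f t : t < G f false t.
Proof. by rewrite -{1}(GK f false t) L_lt. Qed.

Definition T f (u : R -> R) t :=
  rdsp f * u (G f false t) + (1 - rdsp f) * u (G f true t).

Lemma T_le f (u v : R -> R) : (forall t, u t <= v t) -> forall t, T f u t <= T f v t.
Proof.
move=> uv t; have p01 := rdsp_in01 f.
have := uv (G f false t); have := uv (G f true t); rewrite /T; nra.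
Qed.

(** One-sided: the positive part of D vanishes at both ends, while D may stay negative. *)
Definition vanishing_sup (D : R -> R) :=
  forall e, 0 < e -> exists K, forall t, K <= `|t| -> D t <= e.

(** Let M > 0 be the supremum. From D <= T D and D <= M, the deficits satisfy p (M - D (G_0 t)) <= M
    - D t. A number k of steps of G_0 that carries -|K| beyond |K| carries every t in between there
    too, and the deficit beyond is at least M / 2. Hence D <= M - p^k M / 2 everywhere, a
    contradiction. *)
Lemma max_principle f (D : R -> R) : has_ubound (range D) ->
  (forall t, D t <= T f D t) -> vanishing_sup D -> forall t, D t <= 0.
Proof.
move=> ubD sub van t0; rewrite leNgt; apply/negP => Dt0.
have supD : has_sup (range D) by split=> //; exists (D t0), t0.
set M := sup (range D).
have DM t : D t <= M by apply: ub_le_sup => //; exists t.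
have M0 : 0 < M by exact: lt_le_trans Dt0 (DM t0).
have [|K hK] := van (M / 2); first lra.
have [k hk] := iter_gt_unbounded (G_incr f false) (G_gt f) (- `|K|) `|K|.
have p01 := rdsp_in01 f.
have step i t : rdsp f ^+ i * (M - D (iter i (G f false) t)) <= M - D t.
  elim: i t => [|i IH] t; first by rewrite expr0 mul1r.
  rewrite exprSr -mulrA; apply: (le_trans _ (IH t)).
  have ri : 0 <= rdsp f ^+ i by rewrite exprn_ge0//; lra.
  apply: ler_wpM2l => //=; set s := iter i _ _.
  have := sub s; have := DM (G f true s); rewrite /T; nra.
pose d := rdsp f ^+ k * (M / 2).
have pk0 : 0 < rdsp f ^+ k by rewrite exprn_gt0//; lra.
have pk1 : rdsp f ^+ k <= 1 by apply: exprn_ile1; lra.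
have d0 : 0 < d by rewrite /d mulr_gt0//; lra.
have all t : D t <= M - d.
  have [Kt|tK] := leP K `|t|.
    by have := hK _ Kt; rewrite /d; nra.
  have := step k t.
  suff /hK : K <= `|iter k (G f false) t| by rewrite /d; nra.
  have tK' : - `|K| <= t.
    by have := ler_norm K; have := ler_norm (- t); rewrite normrN; lra.
  have inc : {homo iter k (G f false) : x y / x <= y}.
    by move=> x y xy; elim: (k) => //= i IH; rewrite (incr_onto_le (G_incr f false)).
  have := inc _ _ tK'; have := ler_norm K; have := ler_norm (iter k (G f false) t); lra.
have : M <= M - d by apply: ge_sup => [|_ [t _ <-]//]; exact: supD.1.
by lra.
Qed.

(* The drift is positive, and at [alpha = 0] the logarithmic derivative of
   [p * expR (- alpha * A0) + (1 - p) * expR (- alpha * A1)]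
   is its opposite. *)
Lemma exp_drift (p A0 A1 : R) : 0 < p < 1 -> 0 < p * A0 + (1 - p) * A1 ->
  exists2 alpha, 0 < alpha & exists2 r, 0 < r & forall q B0 B1, 0 <= q <= 1 ->
    `|q - p| <= r -> A0 - r <= B0 -> A1 - r <= B1 ->
    q * expR (- (alpha * B0)) + (1 - q) * expR (- (alpha * B1)) <= 1.
Proof.
move=> p01; set D := p * A0 + (1 - p) * A1 => D0.
pose S := `|A0| + `|A1| + 1.
have S1 : 1 <= S by rewrite /S; have := normr_ge0 A0; have := normr_ge0 A1; lra.
pose r := Num.min 1 (D / (4 * S)).
have r0 : 0 < r by rewrite lt_min ltr01 divr_gt0//; lra.
have r1 : r <= 1 by rewrite ge_min lexx.
have rS : r * S <= D / 4.
  have : r <= D / (4 * S) by rewrite ge_min lexx orbT.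
  by rewrite ler_pdivlMr; lra.
(* The first bound gives |alpha (A_i - r)| <= 1/2; the second keeps the quadratic error 2 (alpha
   S)^2 within alpha D / 2, against a linear gain of at least 3 alpha D / 4. *)
pose alpha := Num.min (2 * S)^-1 (D / (4 * S ^+ 2)).
have S20 : 0 < S ^+ 2 by rewrite exprn_gt0//; lra.
have a0 : 0 < alpha by rewrite lt_min invr_gt0 divr_gt0; lra.
have aS : alpha * S <= 2^-1.
  have : alpha <= (2 * S)^-1 by rewrite ge_min lexx.
  by rewrite -[(2 * S)^-1]div1r ler_pdivlMr; lra.
have aS2 : alpha * S ^+ 2 <= D / 4.
  have : alpha <= D / (4 * S ^+ 2) by rewrite ge_min lexx orbT.
  by rewrite ler_pdivlMr; lra.
exists alpha => //; exists r => // q B0 B1 q01 qp hB0 hB1.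
have bound (A B : R) : `|A| + 1 <= S -> A - r <= B ->
    expR (- (alpha * B)) <= 1 - alpha * (A - r) + 2 * (alpha * S) ^+ 2.
  move=> AS AB; pose y := - (alpha * (A - r)).
  have nA : `|A - r| <= S by rewrite (le_trans (ler_normB _ _))// (gtr0_norm r0); lra.
  have yS : `|y| <= alpha * S by rewrite normrN normrM gtr0_norm// ler_wpM2l// ltW.
  apply: (@le_trans _ _ (expR y)); first by rewrite ler_expR lerN2 ler_wpM2l// ltW.
  (* exp y <= 1 / (1 - y) <= 1 + y + 2 y^2, the latter for y <= 1/2. *)
  have : expR y <= (1 - y)^-1.
    rewrite -[y in leLHS]opprK expRN lef_pV2 ?posrE ?expR_gt0//; last first.
      by have := ler_norm y; lra.
    by have := expR_ge1Dx (- y); lra.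
  move=> /le_trans; apply; rewrite -div1r ler_pdivrMr; last by have := ler_norm y; lra.
  have [y1 y2] : - (alpha * S) <= y /\ y <= alpha * S.
    by apply/andP; rewrite -ler_norml.
  have -> : alpha * (A - r) = - y by rewrite /y opprK.
  have sq : y ^+ 2 <= (alpha * S) ^+ 2 by nra.
  have yh : y <= 2^-1 by lra.
  rewrite expr2 in sq *; set z2 := (alpha * S) * (alpha * S) in sq *.
  have yy : 0 <= y * y by rewrite -expr2 sqr_ge0.
  apply: (@le_trans _ _ ((1 + y + 2 * (y * y)) * (1 - y))); first by nra.
  by apply: ler_wpM2r; lra.
have n0 := normr_ge0 A0; have n1 := normr_ge0 A1.
have b0 : expR (- (alpha * B0)) <= 1 - alpha * (A0 - r) + 2 * (alpha * S) ^+ 2.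
  by apply: bound => //; rewrite /S; lra.
have b1 : expR (- (alpha * B1)) <= 1 - alpha * (A1 - r) + 2 * (alpha * S) ^+ 2.
  by apply: bound => //; rewrite /S; lra.
have diff : - (r * (S - 1)) <= (q - p) * (A0 - A1).
  have : `|(q - p) * (A0 - A1)| <= r * (S - 1).
    rewrite normrM ler_pM// (le_trans (ler_normB _ _))// /S; lra.
  by rewrite ler_norml => /andP[].
have z2 : 2 * (alpha * S) ^+ 2 <= alpha * (D / 2).
  rewrite exprMn; have := ler_wpM2l (ltW a0) aS2; lra.
have aux : alpha * (D - r * S) <= alpha * (q * A0 + (1 - q) * A1 - r).
  by apply: ler_wpM2l; [exact: ltW|rewrite /D; lra].
have aux2 : alpha * (r * S) <= alpha * (D / 4) by apply: ler_wpM2l; [exact: ltW|].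
have aD : 0 < alpha * D by rewrite mulr_gt0.
have q0 : 0 <= q by lra.
have q1 : 0 <= 1 - q by lra.
have := ler_wpM2l q0 b0; have := ler_wpM2l q1 b1.
set Z := 2 * (alpha * S) ^+ 2 in z2 *; lra.
Qed.

End rds_lifts.

(** * Stationary distribution functions *)

Section barriers.
Context {R : realType}.
Implicit Types (phi k : R -> R) (D V F : R -> R).

Definition vanishes_low D := forall e, 0 < e -> exists K, forall t, t <= K -> D t <= e.

Lemma vanishing_sup_sides D : vanishes_low D -> vanishes_low (D \o -%R) ->
  vanishing_sup D.
Proof.
move=> lo hi e e0; have [K hK] := lo e e0; have [K' hK'] := hi e e0.
exists (Num.max (- K) (- K')) => t; rewrite ge_max => /andP[Kt Kt'].
have [t0|t0] := leP t 0.
  by apply: hK; move: Kt; rewrite ler0_norm//; lra.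
have := hK' (- t); rewrite /= opprK; apply.
by move: Kt'; rewrite gtr0_norm//; lra.
Qed.

Lemma incr_onto_flip phi : incr_onto phi -> incr_onto (flip phi).
Proof.
move=> h; split => [s t st|y].
  by rewrite /flip ltrN2 (incr_onto_lt h) ltrN2.
by exists (- rinv phi (- y)); rewrite /flip opprK rinvK// opprK.
Qed.

Lemma rinv_flip phi t : incr_onto phi -> rinv (flip phi) (- t) = - rinv phi t.
Proof.
move=> h; have hf := incr_onto_flip h.
by apply: (incr_onto_inj hf); rewrite rinvK// /flip opprK rinvK.
Qed.

(** The value 1 on t >= 0 ensures 1 - W(-t) <= V t for any two barriers V and W, which places the
    subsolution of one end below the supersolution of the other. *)
Definition is_barrier V :=
  [/\ continuous V, forall t, 0 <= V t <= 1, forall t, 0 <= t -> V t = 1 &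
      vanishes_low V].

(** V is min(1, exp (alpha (t + c))) with alpha from [exp_drift]. Where V t = 1 the inequality
    follows from V <= 1; for t < -c the preimages of t are at most t - B j, with B j slightly below
    A j, and the averaged exponential factor is at most 1. *)
Lemma barrier (phi : bool -> R -> R) (A : bool -> R) (p : R) : 0 < p < 1 ->
  (forall j, tail (phi j) (A j)) -> 0 < p * A false + (1 - p) * A true ->
  exists V, [/\ is_barrier V, {homo V : s t / s <= t} &
    exists2 r, 0 < r & forall q (k : bool -> R -> R), 0 <= q <= 1 ->
      `|q - p| <= r -> (forall j, incr_onto (k j)) ->
      (forall j t, `|k j t - phi j t| <= r) ->
      forall t, q * V (rinv (k false) t) + (1 - q) * V (rinv (k true) t) <= V t].
Proof.
move=> p01 tA drift.
have [alpha a0 [r0 r00 hr]] := exp_drift p01 drift.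
have r02 : 0 < r0 / 2 by lra.
have [K0 hK0] := tA false _ r02; have [K1 hK1] := tA true _ r02.
pose K := Num.min K0 K1; pose B j := A j - r0.
have hK j s : s <= K -> A j - r0 / 2 <= phi j s - s.
  rewrite /K le_min => /andP[s0 s1].
  case: j; [have := hK1 _ s1|have := hK0 _ s0]; rewrite ler_distl; lra.
(* For t < -c no preimage of t lies above K, since k j maps K to at least K + B j >= -c. And c >= 0
   gives V = 1 on t >= 0. *)
pose c := Num.max 0 (Num.max (- (K + B false)) (- (K + B true))).
have c0 : 0 <= c by rewrite le_max lexx.
have cB j : - (K + B j) <= c by rewrite !le_max; case: j; rewrite lexx ?orbT.
clearbody c.
pose V t := Num.min 1 (expR (alpha * (t + c))).
have V01 t : 0 <= V t <= 1 by rewrite /V le_min ler01 expR_ge0 ge_min lexx.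
have Vlt t : V t <= expR (alpha * (t + c)) by rewrite /V ge_min lexx orbT.
have V1 t : - c <= t -> V t = 1.
  move=> ct; rewrite /V min_l// -expR0 ler_expR mulr_ge0//; lra.
exists V; split.
- split=> //.
  + have cE : continuous (fun t : R => expR (alpha * (t + c))).
      move=> t; apply: continuous_comp; last exact: continuous_expR.
      apply: continuousM; first exact: cst_continuous.
      by apply: continuousD => //; exact: cst_continuous.
    have c1 : continuous (fun _ : R => 1 : R) by move=> t; exact: cst_continuous.
    exact: (@min_fun_continuous _ R R _ _ c1 cE).
  + by move=> t t0; apply: V1; lra.
  + move=> e e0; exists (ln e / alpha - c) => t te.
    apply: (le_trans (Vlt t)).
    rewrite -[leRHS]lnK ?posrE// ler_expR mulrC -ler_pdivlMr//; lra.
- move=> s t st; rewrite /V le_min ge_min lexx/= ge_min; apply/orP; right.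
  by rewrite ler_expR; apply: ler_wpM2l; [exact: ltW|lra].
- exists (r0 / 2) => // q k q01 qp inc d t.
  have [ct|tc] := leP (- c) t.
    rewrite (V1 _ ct); have := V01 (rinv (k false) t).
    have := V01 (rinv (k true) t); nra.
  have low j : rinv (k j) t <= t - B j.
    set s := rinv (k j) t.
    have ks : k j s = t by rewrite rinvK.
    have kB u : u <= K -> u + B j <= k j u.
      by move=> uK; have := hK j _ uK; have := d j u; rewrite ler_distl /B; lra.
    have [/kB|Ks] := leP s K; first by rewrite ks; lra.
    have : k j K < k j s by rewrite (incr_onto_lt (inc j)).
    by have := kB _ (lexx K); have := cB j; rewrite ks; lra.
  have Vs j : V (rinv (k j) t) <= expR (alpha * (t + c)) * expR (- (alpha * B j)).
    apply: (le_trans (Vlt _)); rewrite -expRD ler_expR -mulrN -mulrDr.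
    by apply: ler_wpM2l; [exact: ltW|have := low j; lra].
  have -> : V t = expR (alpha * (t + c)).
    rewrite /V min_r// -expR0 ler_expR; nra.
  set E := expR (alpha * (t + c)) in Vs *.
  have E0 : 0 < E by exact: expR_gt0.
  have h := hr q (B false) (B true) q01 (le_trans qp _) (lexx _) (lexx _).
  have {}h := h ltac:(lra).
  apply: (@le_trans _ _ (E * (q * expR (- (alpha * B false)) +
    (1 - q) * expR (- (alpha * B true))))).
    rewrite mulrDr mulrCA [E * ((1 - q) * _)]mulrCA.
    by apply: lerD; apply: ler_wpM2l => //; lra.
  by rewrite -[leRHS]mulr1 ler_wpM2l// ltW.
Qed.

End barriers.

(** * Existence, uniqueness and continuity of the fixed point *)

Section stationary_cdf.
Context {R : realType}.
Implicit Types (f g h : RDS R) (D V F : R -> R).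

Lemma barrier_low f : exists V, [/\ is_barrier V, {homo V : s t / s <= t} &
  exists2 r, 0 < r & forall h, dm f h < r -> forall t, T h V t <= V t].
Proof.
have [V [bV nV [r r0 hr]]] := barrier (rdsp_in01 f) (L_tail0 f) (L_drift0 f).
exists V; split=> //; exists r => // h fh t.
have p01 := rdsp_in01 h.
apply: (hr (rdsp h) (L h)); first lra.
- by rewrite distrC (le_trans (rdsp_dist f h))// ltW.
- by move=> j; exact: L_incr.
- by move=> j s; rewrite distrC (le_trans (L_dist f h j s))// ltW.
Qed.

Lemma barrier_high f : exists V, is_barrier V /\
  exists2 r, 0 < r & forall h, dm f h < r ->
    forall t, T h (V \o -%R) t <= V (- t).
Proof.
have [V [bV nV [r r0 hr]]] := barrier (rdsp_in01 f) (L_tail1 f) (L_drift1 f).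
exists V; split=> //; exists r => // h fh t.
have p01 := rdsp_in01 h.
have inc j := incr_onto_flip (L_incr h j).
rewrite /T /= /G -!rinv_flip; try exact: L_incr.
apply: (hr (rdsp h) (fun j => flip (L h j))) => //; first lra.
- by rewrite distrC (le_trans (rdsp_dist f h))// ltW.
- move=> j s; rewrite /flip opprK addrC (le_trans _ (ltW fh))//.
  exact: L_dist.
Qed.

Definition is_cdf f F := [/\ {homo F : s t / s <= t}, forall t, 0 <= F t <= 1,
  forall t, T f F t = F t, vanishes_low F & vanishes_low (fun t => 1 - F (- t))].

Lemma is_cdf_le f F F' : is_cdf f F -> is_cdf f F' -> forall t, F t <= F' t.
Proof.
move=> [_ F01 FT F0 F1] [_ F01' FT' F0' F1'] t; rewrite -subr_le0.
apply: (@max_principle _ f (fun t => F t - F' t)).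
- by exists 1 => _ [s _ <-]; have := F01 s; have := F01' s; lra.
- by move=> s; rewrite -{1}FT -{1}FT' /T; lra.
- apply: vanishing_sup_sides => e e0.
    have [K hK] := F0 _ e0; exists K => s /hK.
    by have := F01' s; lra.
  have [K hK] := F1' _ e0; exists K => s /hK/=.
  by have := F01 (- s); lra.
Qed.

Lemma is_cdf_unique f F F' : is_cdf f F -> is_cdf f F' -> F = F'.
Proof.
move=> h h'; apply/funext => t; apply/le_anti.
by rewrite (is_cdf_le h h') (is_cdf_le h' h).
Qed.

Lemma iter_T_le f V : (forall t, T f V t <= V t) ->
  forall n m, (n <= m)%N -> forall t, iter m (T f) V t <= iter n (T f) V t.
Proof.
move=> TV n m /subnK <-; elim: (m - n)%N => // i IH t.
apply: le_trans (IH t); rewrite addSn.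
by elim: (i + n)%N t => [|l IHl] t; [exact: TV|exact: T_le].
Qed.

Lemma iter_T_ge f V D : (forall t, D t <= T f D t) -> (forall t, D t <= V t) ->
  forall n t, D t <= iter n (T f) V t.
Proof.
move=> TD DV; elim=> //= n IH t.
exact: le_trans (TD t) (T_le f IH t).
Qed.

(** For a supersolution V the iterates decrease and this is their limit; every subsolution below V
    stays below it. *)
Definition iter_inf f V t := inf (range (fun n => iter n (T f) V t)).

Lemma iter_inf_lbound f V D : (forall t, D t <= T f D t) ->
  (forall t, D t <= V t) -> forall t, lbound (range (fun n => iter n (T f) V t)) (D t).
Proof. by move=> TD DV t _ [n _ <-]; exact: iter_T_ge. Qed.

Lemma iter_inf_le f V : (forall t, 0 <= V t) ->
  forall n t, iter_inf f V t <= iter n (T f) V t.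
Proof.
move=> V0 n t; apply: ge_inf; last by exists n.
exists 0; apply: (@iter_inf_lbound f V (fun=> 0)) => //.
by move=> s; rewrite /T !mulr0 addr0.
Qed.

Lemma iter_inf_lt f V t c : (forall t, 0 <= V t) -> iter_inf f V t < c ->
  exists n, iter n (T f) V t < c.
Proof.
move=> V0 /inf_lt[|_ [n _ <-] hn]; last by exists n.
by exists (V t), 0%N.
Qed.

Lemma le_iter_inf f V D : (forall t, D t <= T f D t) ->
  (forall t, D t <= V t) -> forall t, D t <= iter_inf f V t.
Proof.
move=> TD DV t; apply: lb_le_inf; first by exists (V t), 0%N.
exact: iter_inf_lbound.
Qed.

(** T evaluates its argument at two points only, so the decreasing pointwise limit passes through T:
    the larger of two indices serves both points. *)
Lemma iter_inf_fixed f V : (forall t, 0 <= V t) -> (forall t, T f V t <= V t) ->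
  forall t, T f (iter_inf f V) t = iter_inf f V t.
Proof.
move=> V0 TV t; have p01 := rdsp_in01 f; apply/le_anti/andP; split.
  apply: lb_le_inf; first by exists (V t), 0%N.
  move=> _ [n _ <-]; apply: le_trans (iter_T_le TV (leqnSn n) t).
  by apply: T_le => s; exact: iter_inf_le.
apply/ler_addgt0Pr => e e0.
have ex s : exists n, iter n (T f) V s < iter_inf f V s + e.
  by apply: iter_inf_lt => //; lra.
have [n hn] := ex (G f false t); have [m hm] := ex (G f true t).
apply: (le_trans (@iter_inf_le f _ V0 (maxn n m).+1 t)); rewrite iterS.
have := iter_T_le TV (leq_maxl n m) (G f false t).
have := iter_T_le TV (leq_maxr n m) (G f true t).
rewrite /T; nra.
Qed.

(** The iterates descend from the low barrier V and stay above 1 - W(-t), with W the high barrier: V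
    forces the limit 0 at minus infinity, and W the limit 1 at plus infinity. *)
Lemma is_cdf_exists f : exists F, is_cdf f F.
Proof.
have [V [[_ V01 V1 Vlo] nV [r r0 hV]]] := barrier_low f.
have [W [[_ W01 W1 Wlo] [s s0 hW]]] := barrier_high f.
have p01 := rdsp_in01 f.
have {hV} TV := hV f; have {hW} TW := hW f.
rewrite dmxx in TV TW; have {}TV := TV r0; have {}TW := TW s0.
have V0 t : 0 <= V t by have := V01 t; lra.
pose D t := 1 - W (- t).
have TD t : D t <= T f D t by have := TW t; rewrite /D /T/=; lra.
have DV t : D t <= V t.
  rewrite /D; have [t0|t0] := leP 0 t; first by rewrite V1//; have := W01 (- t); lra.
  by rewrite W1 ?subrr//; lra.
exists (iter_inf f V); split.
- move=> u v uv; apply: lb_le_inf; first by exists (V v), 0%N.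
  move=> _ [n _ <-]; apply: (le_trans (@iter_inf_le f _ V0 n u)).
  elim: n u v uv => /= [|n IH] u v uv; first exact: nV.
  have := IH _ _ (ltac:(by rewrite (incr_onto_le (G_incr f false))) :
    G f false u <= G f false v).
  have := IH _ _ (ltac:(by rewrite (incr_onto_le (G_incr f true))) :
    G f true u <= G f true v).
  by rewrite /T; nra.
- move=> t; apply/andP; split.
    apply: (@le_iter_inf f V (fun=> 0)) => // u.
    by rewrite /T !mulr0 addr0.
  by apply: (le_trans (@iter_inf_le f _ V0 0 t)) => /=; have := V01 t; lra.
- exact: iter_inf_fixed.
- move=> e /Vlo[K hK]; exists K => t /hK.
  exact/le_trans/(@iter_inf_le f _ V0 0 t).
- move=> e /Wlo[K hK]; exists K => t /hK.
  by have := le_iter_inf TD DV (- t); rewrite /D opprK; lra.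
Qed.

Definition scdf f : R -> R := xget (fun=> 0) (is_cdf f).

Lemma scdfP f : is_cdf f (scdf f).
Proof.
by rewrite /scdf; case: xgetP => // h; have [F] := is_cdf_exists f; case/h.
Qed.

Lemma scdfE f F : is_cdf f F -> F = scdf f.
Proof. by move=> h; exact: is_cdf_unique h (scdfP f). Qed.

Lemma scdf_le f s t : s <= t -> scdf f s <= scdf f t.
Proof. by have [+ _ _ _ _] := scdfP f; exact. Qed.

Lemma scdf01 f t : 0 <= scdf f t <= 1.
Proof. by have [_ + _ _ _] := scdfP f; exact. Qed.

Lemma scdf_fixed f t : T f (scdf f) t = scdf f t.
Proof. by have [_ _ + _ _] := scdfP f; exact. Qed.

Lemma scdf_low f : vanishes_low (scdf f).
Proof. by have [_ _ _ + _] := scdfP f. Qed.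

Lemma scdf_high f : vanishes_low (fun t => 1 - scdf f (- t)).
Proof. by have [_ _ _ _ +] := scdfP f. Qed.

(** The map sends y - e and y + e strictly to either side of t. Half of this gap absorbs a
    perturbation of the map, the other half a displacement of the point. *)
Lemma G_continuous j : continuous (fun z : RDS R * R => G z.1 j z.2).
Proof.
move=> [f t] /=; apply/cvgrPdist_le => /= e e0.
set y := G f j t.
have inc := L_incr f j.
have lo : L f j (y - e) < t by rewrite -(GK f j t) (incr_onto_lt inc) -/y; lra.
have hi : t < L f j (y + e) by rewrite -(GK f j t) (incr_onto_lt inc) -/y; lra.
pose m := Num.min (t - L f j (y - e)) (L f j (y + e) - t) / 2.
have m0 : 0 < m by rewrite /m divr_gt0// lt_min !subr_gt0 lo.
have m1 : m <= (t - L f j (y - e)) / 2 by rewrite ler_pM2r ?invr_gt0// ge_min lexx.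
have m2 : m <= (L f j (y + e) - t) / 2.
  by rewrite ler_pM2r ?invr_gt0// ge_min lexx orbT.
exists ([set h | dm f h < m], ball t m).
  by split; [exact: near_dm|exact: nbhsx_ballx].
move=> [h s] /= [fh]; rewrite /ball/= ltr_distl => ts.
have inch := L_incr h j.
have a1 : y - e < G h j s.
  rewrite -(incr_onto_lt inch) GK; have := L_dist f h j (y - e).
  by rewrite ler_distl; lra.
have a2 : G h j s < y + e.
  rewrite -(incr_onto_lt inch) GK; have := L_dist f h j (y + e).
  by rewrite ler_distl; lra.
by rewrite ler_distl; lra.
Qed.

Lemma rdsp_continuous : continuous (@rdsp R).
Proof.
move=> f; apply/(@cvgrPdist_le _ _ _ (nbhs f) _) => e e0; near=> h; rewrite (le_trans (rdsp_dist f h))// ltW//.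
by near: h; exact: near_dm.
Unshelve. all: by end_near. Qed.

Lemma iter_T_continuous V n : continuous V ->
  continuous (fun z : RDS R * R => iter n (T z.1) V z.2).
Proof.
move=> cV; elim: n => [|n IH] z /=.
  by apply: continuous_comp; [exact: cvg_snd|exact: cV].
have cp : {for z, continuous (fun z : RDS R * R => rdsp z.1)}.
  by apply: continuous_comp; [exact: cvg_fst|exact: rdsp_continuous].
have cG j : {for z, continuous (fun z : RDS R * R => iter n (T z.1) V (G z.1 j z.2))}.
  apply: (@continuous_comp _ _ _ (fun z : RDS R * R => (z.1, G z.1 j z.2))
    (fun z : RDS R * R => iter n (T z.1) V z.2)); last exact: IH.
  have c1 : (fun z : RDS R * R => z.1) @ z --> z.1 by exact: cvg_fst.
  exact: cvg_pair c1 (@G_continuous j z).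
rewrite /T; apply: cvgD; first by apply: cvgM; [exact: cp|exact: cG].
apply: cvgM; last exact: cG.
by apply: cvgB; [exact: cvg_cst|exact: cp].
Qed.

(* [T f^n V] decreases to the fixed point, and each iterate is jointly continuous
   in the system and the point. *)
Lemma fixed_usc (Phi : RDS R -> R -> R) f t c V :
  (forall h s, T h (Phi h) s = Phi h s) -> (forall h s, 0 <= Phi h s <= 1) ->
  continuous V -> (forall s, 0 <= V s <= 1) ->
  (\forall h \near f, forall s, T h V s <= V s) ->
  (forall h, vanishing_sup (fun s => Phi h s - V s)) ->
  vanishing_sup (fun s => V s - Phi f s) ->
  Phi f t < c -> \forall z \near (f, t), Phi z.1 z.2 < c.
Proof.
move=> fixed Phi01 cV V01 TV van1 van2 tc.
have V0 s : 0 <= V s by have := V01 s; lra.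
have PhiV h : (forall s, T h V s <= V s) -> forall s, Phi h s <= V s.
  move=> TVh s; rewrite -subr_le0.
  apply: (@max_principle _ h (fun s => Phi h s - V s)) => //.
  - by exists 1 => _ [u _ <-]; have := Phi01 h u; have := V01 u; lra.
  - by move=> u; have := TVh u; rewrite -{1}(fixed h) /T; lra.
have TVf := nbhs_singleton TV.
(* The limit of the iterates does not exceed Phi f, so some iterate is already below c at t. *)
have low s : iter_inf f V s - Phi f s <= 0.
  apply: (@max_principle _ f (fun s => iter_inf f V s - Phi f s)).
  - exists 1 => _ [u _ <-]; have := @iter_inf_le f _ V0 0 u; rewrite /=.
    by have := V01 u; have := Phi01 f u; lra.
  - by move=> u; rewrite -{1}(fixed f) -{1}(iter_inf_fixed V0 TVf) /T; lra.
  - move=> e /van2[K hK]; exists K => u /hK; apply: le_trans.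
    by rewrite lerD2r (@iter_inf_le f _ V0 0).
have [|n hn] := @iter_inf_lt f V t c V0; first by have := low t; lra.
have near1 : \forall z \near (f, t), iter n (T z.1) V z.2 < c.
  by apply: (cvgr_lt _ (@iter_T_continuous V n cV (f, t))).
have near2 : \forall z \near (f, t), forall s, T z.1 V s <= V s.
  by apply: (@cvg_fst _ _ _ _ _ _ TV).
near=> z.
apply: (@le_lt_trans _ _ (iter n (T z.1) V z.2)); last by near: z.
apply: iter_T_ge => s; first by rewrite fixed.
by apply: PhiV; near: z.
Unshelve. all: by end_near. Qed.

(** Upper semicontinuity uses the low barrier; lower semicontinuity is the same statement for 1 -
    [scdf], also fixed by T, with the reflected high barrier. *)
Lemma scdf_continuous : continuous (fun z : RDS R * R => scdf z.1 z.2).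
Proof.
move=> [f t]; apply/cvgrPdist_lt => e e0.
have up : \forall z \near (f, t), scdf z.1 z.2 < scdf f t + e.
  have [V [[cV V01 V1 Vlo] nV [r r0 hV]]] := barrier_low f.
  apply: (@fixed_usc scdf f t _ V) => //; [exact: scdf_fixed|exact: scdf01| | |..].
  - by apply: filterS (near_dm f r0) => h /hV.
  - move=> h; apply: vanishing_sup_sides => d d0.
      have [K hK] := scdf_low h d0; exists K => s /hK.
      by have := V01 s; lra.
    exists 0 => s s0 /=; rewrite V1; last by lra.
    by have := scdf01 h (- s); lra.
  - apply: vanishing_sup_sides => d d0.
      have [K hK] := Vlo _ d0; exists K => s /hK.
      by have := scdf01 f s; lra.
    have [K hK] := scdf_high f d0; exists K => s /hK/=.
    by have := V01 (- s); lra.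
  - lra.
have down : \forall z \near (f, t), 1 - scdf z.1 z.2 < 1 - scdf f t + e.
  have [W [[cW W01 W1 Wlo] [r r0 hW]]] := barrier_high f.
  apply: (@fixed_usc (fun h s => 1 - scdf h s) f t _ (W \o -%R)).
  - by move=> h s; rewrite -(scdf_fixed h s) /T; lra.
  - by move=> h s; have := scdf01 h s; lra.
  - by move=> s; apply: continuous_comp; [exact: opp_continuous|exact: cW].
  - by move=> s; exact: W01.
  - by apply: filterS (near_dm f r0) => h /hW.
  - move=> h; apply: vanishing_sup_sides => d d0.
      exists 0 => s s0 /=; rewrite W1; last by lra.
      by have := scdf01 h s; lra.
    have [K hK] := scdf_high h d0; exists K => s /hK/=; rewrite opprK.
    by have := W01 s; lra.
  - apply: vanishing_sup_sides => d d0.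
      have [K hK] := scdf_low f d0; exists K => s /hK/=.
      by have := W01 (- s); lra.
    have [K hK] := Wlo _ d0; exists K => s /hK/=; rewrite opprK.
    by have := scdf01 f (- s); lra.
  - lra.
near=> z; rewrite ltr_distl.
have : scdf z.1 z.2 < scdf f t + e by near: z.
have : 1 - scdf z.1 z.2 < 1 - scdf f t + e by near: z.
by lra.
Unshelve. all: by end_near. Qed.

End stationary_cdf.

(** * Density of full support *)

Section linear_end.
Context {R : realType}.
Implicit Types (phi : R -> R) (K c t : R).

(* A translation by [c] up to [K - 1], joined linearly to [phi] at [K]. *)
Definition glue phi K c t :=
  if t <= K then t + c + (phi K - K - c) * Num.max 0 (t - K + 1) else phi t.

Lemma glue_high phi K c t : K <= t -> glue phi K c t = phi t.
Proof.
rewrite /glue le_eqVlt => /predU1P[<-|Kt]; last by rewrite leNgt Kt.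
by rewrite lexx subrr add0r max_r ?ler01//; lra.
Qed.

Lemma glue_low phi K c t : t <= K - 1 -> glue phi K c t = t + c.
Proof.
move=> tK; rewrite /glue ifT; last by lra.
by rewrite max_l ?mulr0 ?addr0//; lra.
Qed.

Lemma glue_mid phi K c t : c <= phi K - K -> t <= K ->
  c <= glue phi K c t - t <= phi K - K.
Proof.
move=> cd tK; rewrite /glue tK; have [h|h] := leP (t - K + 1) 0; first by lra.
nra.
Qed.

Lemma glue_incr phi K c : incr_onto phi -> c <= phi K - K ->
  incr_onto (glue phi K c).
Proof.
move=> h cd.
have low s t : s < t -> t <= K -> glue phi K c s < glue phi K c t.
  move=> st tK; rewrite /glue tK ifT; last by lra.
  have : Num.max 0 (s - K + 1) <= Num.max 0 (t - K + 1).
    by rewrite ge_max !le_max lexx/=; apply/orP; right; lra.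
  nra.
split=> [s t st|y].
  have [tK|Kt] := leP t K; first exact: low.
  rewrite (glue_high _ _ (ltW Kt)).
  have [sK|Ks] := leP s K; last by rewrite glue_high ?ltW// (incr_onto_lt h).
  apply: (@le_lt_trans _ _ (phi K)); last by rewrite (incr_onto_lt h).
  rewrite -(glue_high phi c (lexx K)).
  by move: sK; rewrite le_eqVlt => /predU1P[->//|sK]; exact/ltW/low.
have [Ky|yK] := leP (phi K) y.
  by exists (rinv phi y); rewrite glue_high ?rinvK// -(incr_onto_le h) rinvK.
have [lo|hi] := leP y (K - 1 + c).
  by exists (y - c); rewrite glue_low; lra.
pose d := 1 + (phi K - K - c).
have d0 : 0 < d by rewrite /d; lra.
pose z := (y - (K - 1 + c)) / d.
have zd : z * d = y - (K - 1 + c) by rewrite divfK// gt_eqF.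
have z0 : 0 < z by rewrite divr_gt0//; lra.
have z1 : z <= 1 by rewrite ler_pdivrMr// /d; lra.
exists (K - 1 + z); rewrite /glue ifT; last by lra.
rewrite max_r; last by lra.
have -> : K - 1 + z - K + 1 = z by lra.
move: zd; rewrite /d mulrDr mulr1; lra.
Qed.

Lemma glue_tail phi K c : tail (glue phi K c) c.
Proof.
move=> e e0; exists (K - 1) => t tK; rewrite glue_low//.
by have -> : t + c - t - c = 0 by [lra]; rewrite normr0 ltW.
Qed.

Lemma glue_flip_tail phi K c (B : R) : tail (flip phi) B -> tail (flip (glue phi K c)) B.
Proof.
move=> tB e e0; have [K' hK'] := tB _ e0; exists (Num.min K' (- K)) => t.
rewrite le_min => /andP[tK' tK]; rewrite /flip glue_high; last by lra.
exact: hK'.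
Qed.

Lemma glue_dist phi K c (A eta : R) : (forall t, t <= K -> `|phi t - t - A| <= eta) ->
  phi K - K - eta <= c <= phi K - K ->
  forall t, `|glue phi K c t - phi t| <= 3 * eta.
Proof.
move=> hA /andP[c1 c2] t; have [tK|Kt] := leP t K.
  have := hA _ tK; have := hA _ (lexx K); have := glue_mid c2 tK.
  by rewrite !ler_distl; lra.
rewrite glue_high; last exact: ltW.
rewrite subrr normr0.
by have := le_trans (normr_ge0 _) (hA _ (lexx K)); lra.
Qed.

End linear_end.

(** * Gaps of the stationary measure and their removal *)

Section full_support.
Context {R : realType}.
Implicit Types (f h : RDS R).

(** The increment of F is a combination, with positive weights, of its nonnegative increments
    between the preimages; if it vanishes, so do both. *)
Lemma scdf_flat_G h j (x y : R) : x <= y -> scdf h x = scdf h y ->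
  scdf h (G h j x) = scdf h (G h j y).
Proof.
move=> xy; rewrite -(scdf_fixed h x) -(scdf_fixed h y) /T.
have p01 := rdsp_in01 h.
have le i : scdf h (G h i x) <= scdf h (G h i y).
  by apply: scdf_le; rewrite (incr_onto_le (G_incr h i)).
have := le false; have := le true => l1 l0 e; apply/le_anti/andP; split.
  by case: j.
case: j; nra.
Qed.

Lemma scdf_flat_between h (x y z : R) : x <= y <= z -> scdf h x = scdf h z ->
  scdf h x = scdf h y.
Proof.
move=> /andP[xy yz] e; apply/le_anti; rewrite scdf_le//= e scdf_le//.
Qed.

(* An interval of measure zero in the linear region spreads over the region by the
   small translation [m * s - n * c], and the measure would vanish. *)
Lemma no_gap h (K s c : R) (n m : nat) (u v : R) :
  (forall t, t <= K -> L h false t = t - s) ->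
  (forall t, t <= K -> L h true t = t + c) -> 0 < s -> 0 < c ->
  let eps := m%:R * s - n%:R * c in
  0 < eps -> u + eps <= v -> v <= K - eps -> scdf h u < scdf h v.
Proof.
move=> L0 L1 s0 c0 eps eps0 uv vK; rewrite lt_neqAle scdf_le ?andbT; last lra.
apply/eqP => Fuv.
have epsE : m%:R * s = n%:R * c + eps by rewrite /eps; lra.
clearbody eps.
have G0 y : y + s <= K -> G h false y = y + s.
  by move=> yK; rewrite -[in LHS](addrK s y) -L0// LK.
have G1 y : y <= K -> G h true y = y - c.
  by move=> yK; rewrite -[in LHS](subrK c y) -L1 ?LK//; lra.
have down i x y : x <= y -> y <= K -> scdf h x = scdf h y ->
    scdf h (x - i%:R * c) = scdf h (y - i%:R * c).
  move=> xy yK e; elim: i => [|i IH]; first by rewrite mul0r !subr0.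
  have ic : 0 <= i%:R * c by rewrite mulr_ge0// ltW.
  rewrite -[i.+1%:R]natr1 mulrDl mul1r !opprD !addrA.
  rewrite -(G1 (x - i%:R * c)) -1?(G1 (y - i%:R * c)); [|lra|lra].
  by apply: scdf_flat_G => //; lra.
have up i x y : x <= y -> y + i%:R * s <= K -> scdf h x = scdf h y ->
    scdf h (x + i%:R * s) = scdf h (y + i%:R * s).
  move=> xy; elim: i => [|i IH] yK e; first by rewrite mul0r !addr0.
  move: yK; rewrite -[i.+1%:R]natr1 mulrDl mul1r !addrA => yK.
  rewrite -(G0 (x + i%:R * s)) -1?(G0 (y + i%:R * s)); [|lra|lra].
  by apply: scdf_flat_G; [lra|apply: IH => //; lra].
(* Moving left first and right afterwards keeps the interval in the linear region. *)
have shift x y : x <= y -> y + eps <= K -> scdf h x = scdf h y ->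
    scdf h (x + eps) = scdf h (y + eps).
  move=> xy yK e; have yK' : y <= K by lra.
  have := up m _ _ _ _ (down n _ _ xy yK' e).
  have E z : z - n%:R * c + m%:R * s = z + eps by lra.
  by rewrite !E; apply; lra.
(* Successive shifts by eps of an interval of length at least eps overlap, so F is constant along
   their union, up to K - eps. *)
have spread x y : x + eps <= y -> y <= K - eps -> scdf h x = scdf h y ->
    scdf h x = scdf h (K - eps).
  move=> xy yK e.
  have both k : y + k%:R * eps <= K ->
      scdf h (x + k%:R * eps) = scdf h (y + k%:R * eps) /\
      scdf h x = scdf h (y + k%:R * eps).
    elim: k => [|k IH]; first by rewrite mul0r !addr0.
    rewrite -natr1 mulrDl mul1r !addrA => yk.
    have ke : 0 <= k%:R * eps by rewrite mulr_ge0// ltW.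
    have [|IH1 IH2] := IH _; first by lra.
    have e1 : scdf h (x + k%:R * eps + eps) = scdf h (y + k%:R * eps + eps).
      by apply: shift => //; lra.
    split=> //; rewrite -e1; apply: scdf_flat_between IH2; lra.
  pose k := Num.truncn ((K - y) / eps).
  have k0 : 0 <= (K - y) / eps by rewrite divr_ge0 ?ltW//; lra.
  have /andP[k1 k2] := truncn_itv k0.
  move: k1 k2; rewrite -/k ler_pdivlMr// ltr_pdivrMr// -natr1 mulrDl mul1r => k1 k2.
  have [|_ e2] := both k; first by lra.
  by apply: scdf_flat_between e2; lra.
(* The null interval can be moved left arbitrarily far by multiples of c; spreading it from there
   identifies F (K - eps) with the limit of F at minus infinity. *)
have F0 : scdf h (K - eps) = 0.
  apply/le_anti; have /andP[-> _] := scdf01 h (K - eps); rewrite andbT.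
  apply/ler_addgt0Pr => e e0; rewrite add0r.
  have [K' hK'] := scdf_low h e0.
  pose i := Num.truncn (`|u - K'| / c).
  have k0 : 0 <= `|u - K'| / c by rewrite divr_ge0// ltW.
  have /andP[_] := truncn_itv k0; rewrite -/i ltr_pdivrMr// => k2.
  have ic : 0 <= i.+1%:R * c by rewrite mulr_ge0// ltW.
  rewrite -(@spread (u - i.+1%:R * c) (v - i.+1%:R * c)); [|lra|lra|].
    by apply: hK'; have := ler_norm (u - K'); lra.
  by apply: down => //; lra.
(* A zero of F at y passes to G_0 y by the fixed point equation; the orbit is unbounded to the
   right, where F tends to 1. *)
have F0k k : scdf h (iter k (G h false) (K - eps)) = 0.
  elim: k => //= k; set y := iter k _ _ => Fy.
  have := scdf_fixed h y; rewrite Fy /T => e.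
  have p01 := rdsp_in01 h.
  have := scdf01 h (G h false y); have := scdf01 h (G h true y).
  move=> h1 h2; apply/le_anti/andP; split; nra.
have [|K' hK'] := scdf_high h (e := 1 / 2); first by lra.
have [k hk] := iter_gt_unbounded (G_incr h false) (G_gt h) (K - eps) (- K').
have := hK' (- iter k (G h false) (K - eps)).
rewrite opprK F0k => /(_ _); lra.
Qed.

Lemma iter_incr (phi : R -> R) k : incr_onto phi -> {homo iter k phi : x y / x < y}.
Proof. by move=> [inc _] x y xy; elim: k => //= k; exact: inc. Qed.

(** Near minus infinity f_0 and f_1 are replaced by translations by -s and [d true], with m s - n
    [d true] = eps small. If F were constant on [a, b], it would be constant on the k-fold preimage
    [u, v] under the new f_1, which lies in the linear region, against [no_gap]. *)
Lemma full_support_dense f (a b e : R) : a < b -> 0 < e ->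
  exists2 h, dm f h < e & scdf h a < scdf h b.
Proof.
move=> ab e0; have drift := L_drift0 f.
set D := rdsp f * _ + _ in drift.
pose eta := Num.min (e / 6) (D / 4).
have eta0 : 0 < eta by rewrite lt_min !divr_gt0.
have eta_e : eta <= e / 6 by rewrite ge_min lexx.
have eta_D : eta <= D / 4 by rewrite ge_min lexx orbT.
clearbody eta.
have [K0 hK0] := L_tail0 f false eta0; have [K1 hK1] := L_tail0 f true eta0.
pose K := Num.min K0 K1.
have hK j t : t <= K -> `|L f j t - t - tail0 f j| <= eta.
  by rewrite le_min => /andP[t0 t1]; case: j; [exact: hK1|exact: hK0].
clearbody K.
pose d j := L f j K - K.
have d0 : d false < 0 by rewrite /d; have := L_lt f K; lra.
have d1 : 0 < d true by rewrite /d; have := L_gt f K; lra.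
(* With displacement [d true] the glued map is an exact translation on t <= K. It is fixed before
   eps, so u and v do not depend on eps. *)
pose phi1 := glue (L f true) K (d true).
have inc1 : incr_onto phi1 by apply: glue_incr => //; exact: L_incr.
have gt1 t : t < phi1 t.
  have [tK|Kt] := leP t K; last by rewrite /phi1 glue_high ?ltW// L_gt.
  by have := @glue_mid _ (L f true) K _ t (lexx _) tK; rewrite -/(d true) -/phi1; lra.
have [k hk] := iter_gt_unbounded inc1 gt1 (K - 2) b.
pose u := iter k (rinv phi1) a; pose v := iter k (rinv phi1) b.
have uv : u < v by apply: iter_incr => //; exact: incr_onto_rinv.
have vK : v <= K - 2.
  rewrite leNgt; apply/negP => /(iter_incr k inc1).
  suff -> : iter k phi1 v = b by lra.
  by rewrite /v; elim: (k) => //= i IH; rewrite -iterS iterSr rinvK.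
pose eps := Num.min 1 (Num.min (v - u) (eta / 2)).
have eps0 : 0 < eps by rewrite !lt_min ltr01 subr_gt0 uv divr_gt0.
have eps1 : eps <= 1 by rewrite ge_min lexx.
have epsuv : eps <= v - u by rewrite !ge_min lexx !orbT.
have epseta : eps <= eta / 2 by rewrite !ge_min lexx !orbT.
clearbody eps.
(* m and n place s between -[d false] and -[d false] + eta: [d true] / m is less than eta / 2, and n
   is the least integer with m (-[d false]) < n [d true]. *)
pose m := (Num.truncn (d true / (eta / 2))).+1.
have eta20 : 0 < eta / 2 by lra.
have m0 : 0 < m%:R :> R by rewrite ltr0n.
have dm' : d true < m%:R * (eta / 2).
  have /andP[_] := truncn_itv (ltW (divr_gt0 d1 eta20)).
  by rewrite ltr_pdivrMr.
have m1 : 1 <= m%:R :> R by rewrite ler1n.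
clearbody m.
pose n := (Num.truncn (m%:R * - d false / d true)).+1.
have dn : n%:R * d true - d true <= m%:R * - d false < n%:R * d true.
  have : 0 <= m%:R * - d false / d true by rewrite divr_ge0 ?mulr_ge0 ?ltW//; lra.
  move=> /truncn_itv; rewrite ltr_pdivrMr// ler_pdivlMr// -/n => /andP[l ->].
  by rewrite /n -natr1 mulrDl mul1r addrK l.
clearbody n.
pose s := (n%:R * d true + eps) / m%:R.
have ms : m%:R * s = n%:R * d true + eps by rewrite mulrC divfK// gt_eqF.
have s_lo : - d false <= s.
  by rewrite -(ler_pM2l m0) ms; lra.
have s_hi : s <= - d false + eta.
  rewrite -(ler_pM2l m0) ms.
  have := ler_wpM2r (ltW eta20) m1; rewrite /=; lra.
pose phi j := if j then phi1 else glue (L f false) K (- s).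
have c0 : - s <= d false by lra.
have [h [hL hp]] : exists h : RDS R, (forall j, L h j = phi j) /\ rdsp h = rdsp f.
  apply: (@RDS_of_lift _ phi (fun j => if j then d true else - s) (tail1 f)).
  - by case=> //=; apply: glue_incr => //; exact: L_incr.
  - by case; exact: glue_tail.
  - by case; apply: glue_flip_tail; exact: L_tail1.
  - move=> t /=; have [tK|Kt] := leP t K; last by rewrite glue_high ?ltW// L_lt.
    by have := glue_mid c0 tK; rewrite -/(d false); lra.
  - exact: gt1.
  - exact: rdsp_in01.
  - have p01 := rdsp_in01 f.
    have := hK false _ (lexx K); have := hK true _ (lexx K).
    rewrite -/(d true) -/(d false) !ler_distl => h1 h0.
    have a1 : tail0 f true - eta <= d true by lra.
    have a0 : tail0 f false - 2 * eta <= - s by lra.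
    rewrite /D in eta_D; nra.
  - exact: L_drift1.
exists h.
  apply: (@le_lt_trans _ _ (3 * eta)); last by lra.
  apply: dm_le; last by rewrite hp subrr normr0; lra.
  move=> j t; rewrite hL distrC; case: j => /=.
  - apply: glue_dist (hK true) _ t.
    by rewrite -/(d true); lra.
  - apply: glue_dist (hK false) _ t.
    by rewrite -/(d false); lra.
rewrite lt_neqAle scdf_le ?andbT; last exact: ltW.
apply/eqP => Fab.
have Fuv i : scdf h (iter i (rinv phi1) a) = scdf h (iter i (rinv phi1) b).
  elim: i => //= i IH.
  have := scdf_flat_G true (ltW (iter_incr i (incr_onto_rinv inc1) ab)) IH.
  by rewrite /G hL.
(* The glued f_0 is a pure translation only up to K - 1; this is why v was brought below K - 2, with
   eps <= 1. *)
have := @no_gap h (K - 1) s (d true) n m u v.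
rewrite /= ms addrAC subrr add0r (Fuv k) ltxx => F; suff : false by []; apply: F => //; last 3 first.
- by lra.
- by lra.
- by lra.
- by move=> t tK; rewrite hL /= glue_low.
- by move=> t tK; rewrite hL /= /phi1 glue_low.
Qed.

End full_support.

(** * Density of almost concentrated measures *)

Section cell_maps.
Context {R : realType}.
Implicit Types (M : nat) (w c s t : R).

(** In the variable s / (1 - s) this is multiplication by 1 / c; hence c^-1 gives the inverse
    map. *)
Definition mobius c s := s / (s + c * (1 - s)).

Lemma mobius_den c s : 0 < c -> 0 <= s < 1 -> 0 < s + c * (1 - s).
Proof.
move=> c0 /andP[s0 s1]; have : 0 < c * (1 - s) by rewrite mulr_gt0//; lra.
lra.
Qed.

Lemma mobius_itv c s : 0 < c -> 0 <= s < 1 -> 0 <= mobius c s < 1.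
Proof.
move=> c0 s01; have d := mobius_den c0 s01; have /andP[s0 s1] := s01.
rewrite /mobius divr_ge0 ?(ltW d)//= ltr_pdivrMr// mul1r.
have : 0 < c * (1 - s) by rewrite mulr_gt0//; lra.
lra.
Qed.

Lemma mobiusK c s : 0 < c -> 0 <= s < 1 -> mobius c^-1 (mobius c s) = s.
Proof.
move=> c0 s01; have d := mobius_den c0 s01.
have cne : c != 0 by rewrite gt_eqF.
have dne : s + c * (1 - s) != 0 by rewrite gt_eqF.
rewrite /mobius; have -> : s / (s + c * (1 - s)) +
    c^-1 * (1 - s / (s + c * (1 - s))) = (s + c * (1 - s))^-1.
  by field; rewrite cne dne.
by rewrite invrK divfK.
Qed.

Lemma mobius_lt c s t : 0 < c -> 0 <= s -> s < t -> t < 1 ->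
  mobius c s < mobius c t.
Proof.
move=> c0 s0 st t1.
have ds : 0 < s + c * (1 - s) by apply: mobius_den => //; lra.
have dt : 0 < t + c * (1 - t) by apply: mobius_den => //; lra.
rewrite /mobius ltr_pdivrMr// mulrAC ltr_pdivlMr//.
have : 0 < c * (t - s) by rewrite mulr_gt0//; lra.
lra.
Qed.

(** With c = s^2, the initial interval of relative length s is stretched over all but a fraction at
    most s of the cell. *)
Lemma mobius_sqr s : 0 < s < 1 -> 1 - s <= mobius (s ^+ 2) s.
Proof.
move=> /andP[s0 s1].
have c0 : 0 < s ^+ 2 by rewrite exprn_gt0.
have d : 0 < s + s ^+ 2 * (1 - s) by apply: mobius_den => //; lra.
rewrite /mobius ler_pdivlMr// -subr_ge0.
have -> : s - (1 - s) * (s + s ^+ 2 * (1 - s)) = s ^+ 2 * (s * (2 - s)) by ring.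
by rewrite mulr_ge0 ?mulr_ge0 ?ltW//; lra.
Qed.

(* Moebius maps fixing the ends of the cells [i * w, (i + 1) * w), - M <= i < M:
   for small [c] most of a cell is the image of a short initial interval. *)
Definition cellmap M w c t :=
  let i := Num.floor (t / w) in
  if (- M%:Z <= i) && (i < M%:Z) then w * (i%:~R + mobius c (t / w - i%:~R)) else t.

Section theory.
Variables (M : nat) (w : R).
Hypothesis w0 : 0 < w.

Let frac_itv t : 0 <= t / w - (Num.floor (t / w))%:~R < 1.
Proof.
have /andP[] := floor_itv (t / w); rewrite intrD; lra.
Qed.

Lemma cellmap_floor c t : 0 < c ->
  Num.floor (cellmap M w c t / w) = Num.floor (t / w).
Proof.
move=> c0; rewrite /cellmap; case: ifP => // _.
rewrite mulrAC divff ?gt_eqF// mul1r; apply: floor_def.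
by have := mobius_itv c0 (frac_itv t); rewrite intrD; lra.
Qed.

Lemma cellmapK c : 0 < c -> cancel (cellmap M w c) (cellmap M w c^-1).
Proof.
move=> c0 t; rewrite {1}/cellmap cellmap_floor//; case: ifP => h.
  rewrite /cellmap h mulrAC divff ?gt_eqF// mul1r addrAC subrr add0r.
  by rewrite mobiusK// addrC subrK mulrC divfK// gt_eqF.
by rewrite /cellmap h.
Qed.

Lemma cellmap_cell c t : 0 < c -> let i := Num.floor (t / w) in
  w * i%:~R <= cellmap M w c t < w * (i + 1)%:~R.
Proof.
move=> c0 /=; have /andP[] := floor_itv (cellmap M w c t / w).
by rewrite cellmap_floor// ler_pdivlMr// ltr_pdivrMr// !(mulrC w) => -> ->.
Qed.

Lemma cellmap_incr c : 0 < c -> incr_onto (cellmap M w c).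
Proof.
move=> c0; split=> [s t st|y]; last first.
  have ci : 0 < c^-1 by rewrite invr_gt0.
  by exists (cellmap M w c^-1 y); have := cellmapK ci y; rewrite invrK.
have stw : s / w < t / w by rewrite ltr_pM2r// invr_gt0.
have := le_floor (ltW stw); rewrite le_eqVlt => /predU1P[e|lt].
  rewrite /cellmap -e; case: ifP => // _.
  rewrite ltr_pM2l// ltrD2l mobius_lt//.
  - by have := frac_itv s; lra.
  - by lra.
  - by have := frac_itv t; rewrite -e; lra.
have /andP[_ h1] := cellmap_cell s c0; have /andP[h2 _] := cellmap_cell t c0.
apply: lt_le_trans h1 (le_trans _ h2).
by rewrite ler_pM2l// ler_int -ltzD1 ltrD2r.
Qed.

Lemma cellmap_dist c t : 0 < c -> `|cellmap M w c t - t| <= w.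
Proof.
move=> c0; have := cellmap_cell t c0 => /=.
have /andP[] := floor_itv (t / w); rewrite ler_pdivlMr// ltr_pdivrMr//.
by rewrite intrD ler_distl; lra.
Qed.

Lemma cellmap_out c t : t < - (M%:R * w) \/ M%:R * w <= t -> cellmap M w c t = t.
Proof.
move=> h; rewrite /cellmap ifF//; apply/negbTE.
rewrite negb_and -ltNge -leNgt floor_lt_int floor_ge_int.
rewrite ltr_pdivrMr// ler_pdivlMr// mulrNz mulNr.
by case: h => ->; rewrite ?orbT.
Qed.

Lemma cellmap_in c (i : nat) s : (i < M.*2)%N -> 0 <= s < 1 ->
  cellmap M w c ((i%:R - M%:R) * w + w * s) = (i%:R - M%:R) * w + w * mobius c s.
Proof.
move=> iM s01; set t := _ + _.
have tw : t / w = (i%:Z - M%:Z)%:~R + s.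
  by rewrite /t intrB; field; rewrite gt_eqF.
have fl : Num.floor (t / w) = i%:Z - M%:Z.
  by apply: floor_def; rewrite tw intrD; lra.
rewrite /cellmap fl ifT; last first.
  apply/andP; split; first by rewrite lerBrDr addNr.
  by rewrite ltrBlDr -PoszD ltz_nat addnn.
by rewrite tw addrAC subrr add0r intrB mulrDr mulrC.
Qed.

End theory.
End cell_maps.

(** * Systems with concentrated stationary measure *)

Section singular.
Context {R : realType}.
Implicit Types (f h : RDS R) (w tau eps : R).

Definition cell (M : nat) w (i : nat) : R := (i%:R - M%:R) * w.

(** The intervals are the initial fractions tau of 2M cells, with lengths taken in the coordinate t.
    For fixed M, w and tau their mass depends continuously on the system, which makes the condition
    open. *)
Definition concentrated f eps := exists M w tau, [/\ 0 < w, 0 < tau < 1,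
  M.*2%:R * (w * tau) < eps &
  1 - eps < \sum_(i < M.*2) (scdf f (cell M w i + w * tau) - scdf f (cell M w i))].

Lemma tail_eq (phi psi : R -> R) (A K : R) : (forall t, t <= K -> psi t = phi t) ->
  tail phi A -> tail psi A.
Proof.
move=> eqK tA e e0; have [K' hK'] := tA _ e0; exists (Num.min K K') => t.
by rewrite le_min => /andP[tK tK']; rewrite eqK// hK'.
Qed.

(** As psi is the identity near both ends, the conjugate maps agree there with those of f, so limit
    displacements and Lyapunov conditions persist; F \o psi solves the fixed point equation of h. *)
Lemma conjugate f (psi psi' : R -> R) (K : R) : incr_onto psi ->
  cancel psi psi' -> cancel psi' psi ->
  (forall t, K <= `|t| -> psi t = t) -> (forall t, K <= `|t| -> psi' t = t) ->
  exists h, [/\ forall j t, L h j t = psi' (L f j (psi t)), rdsp h = rdsp f &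
    scdf h = scdf f \o psi].
Proof.
move=> inc psiK psiK' out out'.
have inc' : incr_onto psi'.
  by split=> [s t st|y]; [rewrite -(incr_onto_lt inc) !psiK'|exists (psi y)].
have Ki := ler_norm K.
have low j t : t <= Num.min (- `|K|) (G f j (- `|K|)) ->
    psi' (L f j (psi t)) = L f j t.
  rewrite le_min => /andP[tK tGK].
  have LK0 : L f j t <= - `|K| by rewrite -(GK f j (- `|K|)) (incr_onto_le (L_incr f j)).
  rewrite out ?out'// ler0_norm//; have := normr_ge0 K; lra.
have high j t : t <= Num.min (- `|K|) (- G f j `|K|) ->
    flip (fun t => psi' (L f j (psi t))) t = flip (L f j) t.
  rewrite le_min => /andP[tK tGK]; rewrite /flip.
  have LK0 : `|K| <= L f j (- t).
    by rewrite -(GK f j `|K|) (incr_onto_le (L_incr f j)); lra.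
  rewrite out ?out'// ger0_norm//; have := normr_ge0 K; lra.
have [h [hL hp]] : exists h : RDS R,
    (forall j, L h j = psi' \o (L f j \o psi)) /\ rdsp h = rdsp f.
  apply: (@RDS_of_lift _ _ (tail0 f) (tail1 f)).
  - by move=> j; apply: incr_onto_comp => //; apply: incr_onto_comp => //; exact: L_incr.
  - by move=> j; apply: tail_eq (low j) _; exact: L_tail0.
  - by move=> j; apply: tail_eq (high j) _; exact: L_tail1.
  - by move=> t /=; rewrite -[ltRHS]psiK (incr_onto_lt inc') L_lt.
  - by move=> t /=; rewrite -[ltLHS]psiK (incr_onto_lt inc') L_gt.
  - exact: rdsp_in01.
  - exact: L_drift0.
  - exact: L_drift1.
exists h; split=> //; first by move=> j t; rewrite hL.
apply/esym/scdfE.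
have GE j t : psi (G h j t) = G f j (psi t).
  apply: (incr_onto_inj (L_incr f j)); rewrite GK.
  by apply: (incr_onto_inj inc'); rewrite psiK -[LHS]/((psi' \o (L f j \o psi)) _) -hL GK.
split.
- by move=> s t st /=; apply: scdf_le; rewrite (incr_onto_le inc).
- by move=> t; exact: scdf01.
- by move=> t; rewrite /T /= !GE -[RHS]scdf_fixed hp.
- move=> e /(scdf_low f)[K' hK']; exists (Num.min (- `|K|) K') => t.
  rewrite le_min /= => /andP[tK tK']; rewrite out ?hK'//.
  rewrite ler0_norm//; have := normr_ge0 K; lra.
- move=> e /(scdf_high f)[K' hK']; exists (Num.min (- `|K|) K') => t.
  rewrite le_min /= => /andP[tK tK']; rewrite out ?hK'//.
  rewrite normrN ler0_norm//; have := normr_ge0 K; lra.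
Qed.

Lemma scdf_continuous_snd f : continuous (scdf f).
Proof.
move=> t; apply: (@continuous_comp _ _ _ (fun t : R => (f, t))
  (fun z : RDS R * R => scdf z.1 z.2)); last exact: scdf_continuous.
have c1 : (fun _ : R => f) @ t --> f by exact: cvg_cst.
have c0 : (fun t : R => t) @ t --> t by exact: cvg_id.
exact: cvg_pair c1 c0.
Qed.

Lemma scdf_continuous_fst (t : R) f : scdf h t @[h --> f] --> scdf f t.
Proof.
apply: (@continuous_comp _ _ _ (fun f : RDS R => (f, t))
  (fun z : RDS R * R => scdf z.1 z.2)); last exact: scdf_continuous.
have c1 : (fun _ : RDS R => t) @ f --> t.
  by apply: cvg_cst; exact: nbhs_filter.
have c0 : (fun f : RDS R => f) @ f --> f by exact: cvg_id.
exact: cvg_pair c0 c1.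
Qed.

(** Conjugation by [cellmap] changes the system little once the cells are short, whatever c is.
    Taking c = tau^2 with tau small then gathers nearly all the mass of each cell in its initial
    fraction tau. *)
Lemma concentrated_dense f (e eps : R) : 0 < e -> 0 < eps ->
  exists2 h, dm f h < e & concentrated h eps.
Proof.
move=> e0 eps0.
have eps8 : 0 < eps / 8 by lra.
have [K0 hK0] := scdf_low f eps8; have [K1 hK1] := scdf_high f eps8.
pose k := (Num.truncn (`|K0| + `|K1|)).+1.
have kK : `|K0| + `|K1| < k%:R.
  by have /andP[] := truncn_itv (addr_ge0 (normr_ge0 K0) (normr_ge0 K1)).
have F0 : scdf f (- k%:R) <= eps / 8.
  apply: hK0; have := ler_norm (- K0); have := normr_ge0 K1; rewrite normrN; lra.
have F1 : 1 - eps / 8 <= scdf f k%:R.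
  have := hK1 (- k%:R); rewrite opprK => h.
  suff /h : - k%:R <= K1 by lra.
  have := ler_norm (- K1); have := normr_ge0 K0; rewrite normrN; lra.
clearbody k.
have e3 : 0 < e / 3 by lra.
have uc j := segment_unif_continuous (- k%:R) k%:R
  (incr_onto_continuous (L_incr f j)) e3.
have [d0 d00 hd0] := uc false; have [d1 d10 hd1] := uc true.
pose d := Num.min (e / 3) (Num.min d0 d1).
have dpos : 0 < d by rewrite !lt_min e3 d00.
have de : d <= e / 3 by rewrite ge_min lexx.
have hd j s t : - k%:R <= s <= k%:R -> `|s - t| <= d -> `|L f j s - L f j t| <= e / 3.
  move=> sk; rewrite !le_min => /and3P[_ st0 st1].
  by case: j; [exact: hd1|exact: hd0].
clearbody d.
pose N := (Num.truncn d^-1).+1.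
have N0 : 0 < N%:R :> R by rewrite ltr0n.
have Nd : d^-1 < N%:R by have /andP[] := truncn_itv (ltW (ltac:(by rewrite invr_gt0) : 0 < d^-1)).
pose w : R := N%:R^-1.
have w0 : 0 < w by rewrite invr_gt0.
have wd : w <= d by rewrite -[d]invrK lef_pV2 ?posrE ?invr_gt0// ltW.
pose M := (k * N)%N.
have Mw : M%:R * w = k%:R by rewrite natrM mulfK// gt_eqF.
clearbody M w.
(* Each cell will lose at most eta of its mass, and the 2M cells at most eps / 2; the outside of
   [-k, k] costs eps / 4. *)
pose eta := eps / (4 * (M%:R + 1)).
have M0 : 0 <= M%:R :> R by exact: ler0n.
have eta0 : 0 < eta by rewrite divr_gt0//; lra.
have etaM : M.*2%:R * eta <= eps / 2.
  rewrite -muln2 natrM /eta.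
  have -> : M%:R * 2 * (eps / (4 * (M%:R + 1))) = eps / 2 * (M%:R / (M%:R + 1)).
    by field; rewrite gt_eqF//; lra.
  rewrite -[leRHS]mulr1 ler_wpM2l//; first lra.
  by rewrite ler_pdivrMr; lra.
clearbody eta; clear N0 Nd.
have [d2 d20 hd2] := segment_unif_continuous (- k%:R) k%:R
  (@scdf_continuous_snd f) eta0.
have k0 : 0 <= k%:R :> R by exact: ler0n.
(* The second bound makes the total length 2 k tau less than eps; the third gives w tau <= d2, so
   that F varies by at most eta over the uncovered end of a cell. *)
pose tau := Num.min 2^-1 (Num.min (eps / (4 * (k%:R + 1))) (d2 / w)).
have tau0 : 0 < tau by rewrite !lt_min invr_gt0 ltr0n/= !divr_gt0//; lra.
have tau1 : tau <= 2^-1 by rewrite ge_min lexx.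
have tau2 : tau * (4 * (k%:R + 1)) <= eps.
  have : tau <= eps / (4 * (k%:R + 1)) by rewrite !ge_min lexx !orbT.
  by rewrite ler_pdivlMr//; lra.
have tau3 : w * tau <= d2.
  have : tau <= d2 / w by rewrite !ge_min lexx !orbT.
  by rewrite ler_pdivlMr// mulrC.
clearbody tau.
have tau01 : 0 < tau < 1 by clear -tau0 tau1; lra.
pose c := tau ^+ 2.
have c0 : 0 < c by rewrite exprn_gt0.
have ci0 : 0 < c^-1 by rewrite invr_gt0.
have mc : 1 - tau <= mobius c tau by exact: mobius_sqr.
clearbody c.
have out c' t : k%:R + 1 <= `|t| -> cellmap M w c' t = t.
  move=> kt; apply: cellmap_out => //; rewrite Mw.
  have [t0|t0] := leP 0 t; [right|left].
    by move: kt; rewrite ger0_norm//; clear; lra.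
  by move: kt; rewrite ltr0_norm//; clear; lra.
have canK : cancel (cellmap M w c^-1) (cellmap M w c).
  by rewrite -{2}[c]invrK; exact: cellmapK.
have [h [hL hp hF]] := @conjugate f _ _ _ (cellmap_incr M w0 c0)
  (cellmapK M w0 c0) canK (out c) (out c^-1).
exists h.
  apply: (@le_lt_trans _ _ (e / 3 + e / 3)); last by clear -e0; lra.
  apply: dm_le; last by rewrite hp subrr normr0; clear -e0; lra.
  move=> j t; rewrite hL distrC; set s := cellmap M w c t.
  apply: (le_trans (ler_distD (L f j s) _ _)); apply: lerD.
    exact: le_trans (cellmap_dist _ w0 _ ci0) (le_trans wd de).
  have [t1|kt] := ltP t (- k%:R).
    by rewrite /s cellmap_out ?subrr ?normr0 ?Mw; [exact: ltW|exact: w0|left].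
  have [tk|t1] := ltP t k%:R; last first.
    by rewrite /s cellmap_out ?subrr ?normr0 ?Mw; [exact: ltW|exact: w0|right].
  rewrite distrC; apply: hd; first by clear -kt tk; lra.
  by rewrite distrC (le_trans (cellmap_dist _ w0 _ c0)).
exists M, w, tau; split => //.
  have -> : M.*2%:R * (w * tau) = 2 * (M%:R * w) * tau.
    by rewrite -muln2 natrM; ring.
  rewrite Mw.
  by clear -tau2 tau0 k0 eps0; nra.
pose x (i : nat) := cell M w i.
have cellS i : x i.+1 = x i + w by rewrite /x /cell -natr1; ring.
(* [cellmap] fixes the left end of a cell and stretches its initial fraction tau over at least 1 -
   tau of it; the rest has length at most w tau. *)
have lower (i : nat) : (i < M.*2)%N -> scdf f (x i.+1) - scdf f (x i) - eta <=
    scdf h (x i + w * tau) - scdf h (x i).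
  move=> iM; rewrite hF /=.
  have -> : cellmap M w c (x i) = x i.
    have := @cellmap_in _ M w w0 c i 0 iM; rewrite lexx ltr01 => /(_ isT).
    by rewrite /mobius mul0r mulr0 addr0.
  have -> : cellmap M w c (x i + w * tau) = x i + w * mobius c tau.
    by apply: cellmap_in => //; clear -tau01; lra.
  have kE : (i.+1%:R - M%:R) * w <= k%:R.
    rewrite -Mw ler_pM2r//.
    have : (i.+1%:R : R) <= M.*2%:R by rewrite ler_nat.
    by rewrite -muln2 natrM; clear; lra.
  have kE' : - k%:R <= (i%:R - M%:R) * w.
    by rewrite -Mw -mulNr ler_pM2r//; have := ler0n R i; clear; lra.
  have : `|scdf f (x i.+1) - scdf f (x i.+1 - w * tau)| <= eta.
    apply: hd2; last by rewrite opprD addNKr opprK gtr0_norm// mulr_gt0.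
    by apply/andP; split; [rewrite cellS /x /cell; clear -w0 kE'; lra|exact: kE].
  have : scdf f (x i.+1 - w * tau) <= scdf f (x i + w * mobius c tau).
    apply: scdf_le; rewrite cellS -addrA lerD2l.
    have := ler_wpM2l (ltW w0) mc; rewrite mulrBr mulr1; clear; lra.
  by rewrite ler_distl; clear; lra.
apply: (@lt_le_trans _ _ (\sum_(i < M.*2) (scdf f (x i.+1) - scdf f (x i) - eta))).
  rewrite sumrB sumr_const card_ord -[eta *+ _]mulr_natl.
  have -> : \sum_(i < M.*2) (scdf f (x i.+1) - scdf f (x i)) = scdf f k%:R - scdf f (- k%:R).
    rewrite -(big_mkord xpredT (fun i => scdf f (x i.+1) - scdf f (x i))).
    rewrite telescope_sumr//; congr (scdf f _ - scdf f _).
      by rewrite /x /cell -muln2 natrM -Mw; ring.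
    by rewrite /x /cell -Mw; ring.
  clear -etaM F0 F1 eps0; lra.
by apply: ler_sum => i _; exact: lower.
Qed.

Lemma concentrated_open (eps : R) : open [set f : RDS R | concentrated f eps].
Proof.
rewrite openE => f [M [w [tau [w0 tau01 small big]]]]; rewrite /interior /=.
pose S (h : RDS R) := \sum_(i < M.*2) (scdf h (cell M w i + w * tau) - scdf h (cell M w i)).
have cS : S h @[h --> f] --> S f.
  rewrite /S; elim: (M.*2) => [|n IH].
    by under eq_fun do rewrite big_ord0; rewrite big_ord0; apply: cvg_cst; exact: nbhs_filter.
  under eq_fun do rewrite big_ord_recr/=; rewrite big_ord_recr/=.
  by apply: cvgD IH _; apply: cvgB; exact: scdf_continuous_fst.
have : \forall h \near f, 1 - eps < S h by apply: (cvgr_gt _ cS).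
by apply: filterS => h hS; exists M, w, tau.
Qed.

Lemma scdf_lt_open (a b : R) : open [set f : RDS R | scdf f a < scdf f b].
Proof.
rewrite openE => f ab; rewrite /interior.
have cS : scdf h b - scdf h a @[h --> f] --> scdf f b - scdf f a.
  exact: (cvgB (@scdf_continuous_fst b f) (@scdf_continuous_fst a f)).
have : \forall h \near f, 0 < scdf h b - scdf h a.
  by apply: (cvgr_gt _ cS); rewrite subr_gt0.
by apply: filterS => h; rewrite subr_gt0.
Qed.

End singular.

(** * The Baire property *)

Section baire.
Context {R : realType}.
Implicit Types (f g h : RDS R).

(** The intervals of centre x n and radius r n meet pairwise, so the supremum of their left ends
    belongs to all of them. *)
Lemma cauchy_limit (x r : nat -> R) :
  (forall n m, (n <= m)%N -> `|x n - x m| <= r n) ->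
  exists l, forall n, `|x n - l| <= r n.
Proof.
move=> h; pose S := range (fun n => x n - r n).
have le n m : x n - r n <= x m + r m.
  have [nm|mn] := leqP n m.
    have := h n m nm; have := h m m (leqnn m); rewrite subrr normr0 ler_distl; lra.
  have := h m n (ltnW mn); have := h n n (leqnn n); rewrite subrr normr0 ler_distl; lra.
exists (sup S) => n; rewrite ler_distl; apply/andP; split.
  rewrite lerBlDr.
  by apply: ge_sup => [|_ [m _ <-]]; [exists (x n - r n), n|exact: le].
rewrite -lerBlDr; apply: ub_le_sup; last by exists n.
by exists (x 0%N + r 0%N) => _ [m _ <-].
Qed.

(* Strict inequalities which hold for [f] with a margin allowing perturbations of
   size [r]; all of them together characterise the limits which lie in [RDS]. *)
Definition margin (n : nat) f (r : R) := [/\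
  forall a b : rat, unpickle n = Some (a, b) -> a < b -> forall j,
    2 * r < L f j (ratr b) - L f j (ratr a),
  forall t, `|t| <= n%:R -> r < t - L f false t /\ r < L f true t - t,
  r < rdsp f /\ r < 1 - rdsp f,
  r * (1 + `|tail0 f false| + `|tail0 f true|) <
    rdsp f * tail0 f false + (1 - rdsp f) * tail0 f true &
  r * (1 + `|tail1 f false| + `|tail1 f true|) <
    rdsp f * tail1 f false + (1 - rdsp f) * tail1 f true].

Lemma small_mul (x y : R) : 0 <= x -> 0 < y ->
  exists2 r, 0 < r & forall s, s <= r -> s * (1 + x) < y.
Proof.
move=> x0 y0; have x1 : 0 < 1 + x by lra.
exists (y / (2 * (1 + x))); first by rewrite divr_gt0// mulr_gt0.
by move=> s; rewrite ler_pdivlMr ?mulr_gt0//; lra.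
Qed.

Lemma segment_gap (phi psi : R -> R) (n : nat) : continuous phi -> continuous psi ->
  (forall t, phi t < psi t) ->
  exists2 r, 0 < r & forall s t, s <= r -> `|t| <= n%:R -> s < psi t - phi t.
Proof.
move=> cphi cpsi lt.
have n0 : - n%:R <= n%:R :> R by have := ler0n R n; lra.
have [|c _ hc] := @EVT_min R (fun t => psi t - phi t) _ _ n0.
  by apply: continuous_subspaceT => t; apply: cvgB; [exact: cpsi|exact: cphi].
exists ((psi c - phi c) / 2); first by rewrite divr_gt0// subr_gt0.
move=> s t sr tn; have := hc t; rewrite in_itv/= -ler_norml => /(_ tn).
by have := lt c; lra.
Qed.

Lemma margin_exists n f : exists2 r0, 0 < r0 & forall r, r <= r0 -> margin n f r.
Proof.
have [ra ra0 ha] : exists2 r, 0 < r & forall s, s <= r -> forall a b : rat,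
    unpickle n = Some (a, b) -> a < b -> forall j,
    2 * s < L f j (ratr b) - L f j (ratr a).
  case: (unpickle n) => [[a b]|]; last by exists 1.
  have [ab|ba] := boolP (a < b); last first.
    by exists 1 => // s _ a' b' [<- <-]; rewrite (negbTE ba).
  pose g j := L f j (ratr b) - L f j (ratr a).
  have g0 j : 0 < g j by rewrite subr_gt0 (incr_onto_lt (L_incr f j)) ltr_rat.
  exists (Num.min (g false) (g true) / 4); first by rewrite divr_gt0// lt_min !g0.
  move=> s sg a' b' [<- <-] _ j; rewrite -/(g j).
  have : Num.min (g false) (g true) <= g j by rewrite ge_min; case: j; rewrite lexx ?orbT.
  by have := g0 j; lra.
have cid : continuous (fun t : R => t) by move=> t; exact: cvg_id.
have cL j : continuous (L f j) by exact/incr_onto_continuous/L_incr.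
have [rb rb0 hb] := segment_gap n (cL false) cid (L_lt f).
have [rc rc0 hc] := segment_gap n cid (cL true) (L_gt f).
have [rd rd0 hd] := small_mul (addr_ge0 (normr_ge0 (tail0 f false)) (normr_ge0 (tail0 f true)))
  (L_drift0 f).
have [re re0 he] := small_mul (addr_ge0 (normr_ge0 (tail1 f false)) (normr_ge0 (tail1 f true)))
  (L_drift1 f).
have p01 := rdsp_in01 f.
pose rp := Num.min (rdsp f) (1 - rdsp f) / 2.
have rp0 : 0 < rp by rewrite divr_gt0// lt_min; lra.
have rp1 : rp < rdsp f.
  have : Num.min (rdsp f) (1 - rdsp f) <= rdsp f by rewrite ge_min lexx.
  by rewrite /rp; lra.
have rp2 : rp < 1 - rdsp f.
  have : Num.min (rdsp f) (1 - rdsp f) <= 1 - rdsp f by rewrite ge_min lexx orbT.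
  by rewrite /rp; lra.
exists (Num.min ra (Num.min rb (Num.min rc (Num.min rd (Num.min re rp))))).
  by rewrite !lt_min ra0 rb0 rc0 rd0 re0 rp0.
move=> r; rewrite !le_min => /and5P[rra rrb rrc rrd /andP[rre rrp]].
split=> //.
- exact: ha.
- by move=> t tn; split; [exact: hb|exact: hc].
- by split; lra.
- by rewrite -addrA; exact: hd.
- by rewrite -addrA; exact: he.
Qed.

(** Replacing q by p changes the drift by at most r (|a0| + |a1|), and replacing each a by A by at
    most r: the margin covers both. *)
Lemma limit_drift (p q A0 A1 a0 a1 r : R) : 0 <= p <= 1 -> `|q - p| <= r ->
  `|a0 - A0| <= r -> `|a1 - A1| <= r ->
  r * (1 + `|a0| + `|a1|) < q * a0 + (1 - q) * a1 -> 0 < p * A0 + (1 - p) * A1.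
Proof.
move=> p01 qp h0 h1 hr.
have diff : (q - p) * (a0 - a1) <= r * (`|a0| + `|a1|).
  apply: le_trans (ler_norm _) _; rewrite normrM ler_pM//.
  exact: ler_normB.
move: h0 h1; rewrite !ler_distl => h0 h1.
have : p * (a0 - r) <= p * A0 by apply: ler_wpM2l; lra.
have : (1 - p) * (a1 - r) <= (1 - p) * A1 by apply: ler_wpM2l; lra.
lra.
Qed.

(** Nested closed balls with radii at least halved. The margin of stage n is taken at the next
    centre with the next radius, so it survives in every limit within that radius. *)
Definition nested (s : nat -> RDS R) (r : nat -> R) := forall n,
  [/\ 0 < r n, r n.+1 <= r n / 2, dm (s n) (s n.+1) + r n.+1 <= r n &
      margin n (s n.+1) (r n.+1)].

Lemma nested_dist s r n m : nested s r -> (n <= m)%N -> dm (s n) (s m) <= r n.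
Proof.
move=> sr nm; suff : dm (s n) (s m) + r m <= r n by have [] := sr m; lra.
move: nm => /subnK <-; elim: (m - n)%N => [|i IH]; first by rewrite dmxx add0r.
have [_ _ + _] := sr (i + n)%N; have := dm_triangle (s (i + n)) (s n) (s (i + n).+1).
by rewrite addSn; lra.
Qed.

Lemma nested_small s r (e : R) : nested s r -> 0 < e -> exists n, r n <= e.
Proof.
(* Halving gives r n (n + 1) <= r 0, because n + 2 <= 2 (n + 1). *)
move=> sr e0; have bound n : r n * n.+1%:R <= r 0%N.
  elim: n => [|n IH]; first by rewrite mulr1.
  apply: le_trans IH; have [h2 h1 _ _] := sr n; have [h3 _ _ _] := sr n.+1.
  have n1 : 1 <= n.+1%:R :> R by rewrite ler1n.
  have : r n.+1 * n.+2%:R <= r n / 2 * n.+2%:R by apply: ler_wpM2r.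
  have : r n * 1 <= r n * n.+1%:R by apply: ler_wpM2l => //; exact: ltW.
  by rewrite -(natr1 n.+1) mulrDr; lra.
have [r0 _ _ _] := sr 0%N.
pose n := Num.truncn (r 0%N / e); exists n.
have /andP[_] := truncn_itv (ltW (divr_gt0 r0 e0)).
rewrite -/n ltr_pdivrMr// => h.
have n1 : 0 < n.+1%:R :> R by rewrite ltr0n.
by rewrite -(ler_pM2r n1) (le_trans (bound n))// mulrC ltW.
Qed.

(** The lifted maps, the probability and the limit displacements converge separately. The margins
    keep the inequalities strict, and approximate preimages with the absence of jumps give
    surjectivity. *)
Lemma nested_limit s r : nested s r -> exists f, forall n, dm (s n) f <= r n.
Proof.
move=> sr; have s_dist n m : (n <= m)%N -> dm (s n) (s m) <= r n.
  exact: nested_dist.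
have r_small (e : R) : 0 < e -> exists n, r n <= e by exact: nested_small.
have s_margin n : margin n (s n.+1) (r n.+1) by have [] := sr n.
have /choice[p' hp'] : forall u : unit, exists p, forall n, `|rdsp (s n) - p| <= r n.
  move=> _; apply: cauchy_limit => n m nm.
  by apply: le_trans (s_dist _ _ nm); exact: rdsp_dist.
pose p := p' tt; have hp := hp' tt; rewrite -/p in hp.
have /choice[phi' hphi'] : forall z : bool * R,
    exists l, forall n, `|L (s n) z.1 z.2 - l| <= r n.
  move=> [j t]; apply: cauchy_limit => n m nm.
  by apply: le_trans (s_dist _ _ nm); exact: L_dist.
pose phi j t := phi' (j, t).
have hphi j t n : `|L (s n) j t - phi j t| <= r n by exact: (hphi' (j, t)).
have /choice[A hA] : forall j, exists l, forall n, `|tail0 (s n) j - l| <= r n.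
  move=> j; apply: cauchy_limit => n m nm; apply: le_trans (s_dist _ _ nm).
  by apply: tail_dist (L_tail0 _ j) (L_tail0 _ j) _ => t; exact: L_dist.
have /choice[B hB] : forall j, exists l, forall n, `|tail1 (s n) j - l| <= r n.
  move=> j; apply: cauchy_limit => n m nm; apply: le_trans (s_dist _ _ nm).
  apply: tail_dist (L_tail1 _ j) (L_tail1 _ j) _ => t; rewrite /flip.
  by rewrite opprK addrC distrC; exact: L_dist.
have phi_le j : {homo phi j : x y / x <= y}.
  move=> x y xy; apply/ler_addgt0Pr => e e0.
  have e20 : 0 < (e : R) / 2 by lra.
  have [n] := r_small _ e20.
  have := hphi j x n; have := hphi j y n.
  have : L (s n) j x <= L (s n) j y by rewrite (incr_onto_le (L_incr _ _)).
  by rewrite !ler_distl; clear; lra.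
have phi_lt j : {homo phi j : x y / x < y}.
  (* Two rationals a < b are inserted between x and y; at the stage coded by (a, b) their images are
     more than 2 r apart, and each moves by at most r in the limit. *)
  move=> x y xy; have [a] := rat_in_itvoo xy; rewrite in_itv/= => /andP[xa ay].
  have [b] := rat_in_itvoo ay; rewrite in_itv/= => /andP[ab bY].
  have [h _ _ _ _] := s_margin (pickle (a, b)).
  have := h a b (pickleK _) _ j; rewrite -(ltr_rat R) => /(_ ab).
  set n := (pickle _).+1.
  have := hphi j (ratr a) n; have := hphi j (ratr b) n.
  have := phi_le j _ _ (ltW xa); have := phi_le j _ _ (ltW bY).
  by rewrite !ler_distl; clear; lra.
have near_tail (F : R -> R) (F' : nat -> R -> R) (l : R) (l' : nat -> R) :
    (forall n, tail (F' n) (l' n)) -> (forall n t, `|F' n t - F t| <= r n) ->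
    (forall n, `|l' n - l| <= r n) -> tail F l.
  move=> tF hF hl e e0; have e30 : 0 < e / 3 by lra.
  have [n hn] := r_small _ e30; have [K hK] := tF n _ e30; exists K => t tK.
  move: hn (hK t tK) (hF n t) (hl n); rewrite !ler_distl; clear; lra.
have [_ _ m3 m4 m5] := s_margin 0%N.
have p01 : 0 < p < 1.
  by move: m3 (hp 1%N) => []; rewrite ler_distl; clear; lra.
have [f [hL hf]] : exists f : RDS R, (forall j, L f j = phi j) /\ rdsp f = p.
  apply: (@RDS_of_lift _ phi A B p) => //.
  - move=> j; apply: incr_onto_approx => // y e e0.
    have [n hn] := r_small _ e0; exists (G (s n) j y).
    by have := hphi j (G (s n) j y) n; rewrite GK distrC => /le_trans; exact.
  - move=> j; apply: (near_tail _ (fun n => L (s n) j) _ (fun n => tail0 (s n) j)) => //.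
    by move=> n; exact: L_tail0.
  - move=> j; apply: (near_tail _ (fun n => flip (L (s n) j)) _ (fun n => tail1 (s n) j)) => //.
      by move=> n; exact: L_tail1.
    by move=> n t; rewrite /flip opprK addrC distrC; exact: hphi.
  - move=> t; pose n := (Num.truncn `|t|).+1.
    have /andP[_ /ltW tn] := truncn_itv (normr_ge0 t).
    have [_ h _ _ _] := s_margin n; have [h1 _] := h t tn.
    by move: h1 (hphi false t n.+1); rewrite ler_distl; clear; lra.
  - move=> t; pose n := (Num.truncn `|t|).+1.
    have /andP[_ /ltW tn] := truncn_itv (normr_ge0 t).
    have [_ h _ _ _] := s_margin n; have [_ h1] := h t tn.
    by move: h1 (hphi true t n.+1); rewrite ler_distl; clear; lra.
  - by apply: limit_drift (hp 1%N) (hA false 1%N) (hA true 1%N) m4; lra.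
  - by apply: limit_drift (hp 1%N) (hB false 1%N) (hB true 1%N) m5; lra.
exists f => n; apply: dm_le; last by rewrite hf; exact: hp.
by move=> j t; rewrite hL; exact: hphi.
Qed.

Lemma RDS_baire : baire_space (RDS R).
Proof.
move=> U hU O [f0 Of0] oO.
have [e0 e00 he0] := open_dm oO Of0.
(* The positivity of the radius sits inside the statement, so that it holds for every triple and
   [choice] yields a function to iterate. *)
have step (z : nat * (RDS R * R)) : exists y : RDS R * R, 0 < z.2.2 ->
    [/\ 0 < y.2, y.2 <= z.2.2 / 2, dm z.2.1 y.1 + y.2 <= z.2.2,
        margin z.1 y.1 y.2 & forall g, dm y.1 g <= y.2 -> U z.1 g].
  case: z => n [f r] /=; have [r0|r0] := ltP 0 r; last by exists (f, r); lra.
  have r20 : 0 < r / 2 by lra.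
  have [oU dU] := hU n.
  have [|g [/= fg Ug]] := dU (interior [set g | dm f g < r / 2]) _ (open_interior _).
    by exists f; exact: near_dm.
  have {}fg : dm f g < r / 2 by exact: (interior_subset fg).
  have [e ePos he] := open_dm oU Ug.
  have [m m0 hm] := margin_exists n g.
  pose r' := Num.min (r / 2) (Num.min (e / 2) m).
  have r'0 : 0 < r' by rewrite !lt_min r20 m0 divr_gt0.
  have r'1 : r' <= r / 2 by rewrite ge_min lexx.
  have r'2 : r' <= e / 2 by rewrite !ge_min lexx !orbT.
  have r'3 : r' <= m by rewrite !ge_min lexx !orbT.
  exists (g, r') => _ /=; split => //; first by lra.
    exact: hm.
  by move=> k gk; apply: he; lra.
have [F hF] := choice step.
pose z := fix z n := if n is n'.+1 then F (n', z n') else (f0, e0 / 2).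
have z0 n : 0 < (z n).2.
  elim: n => /= [|n IH]; first by lra.
  by have [] := hF (n, z n) IH.
have hz n := hF (n, z n) (z0 n).
have [|f hf] := @nested_limit (fun n => (z n).1) (fun n => (z n).2).
  by move=> n; have [] := hz n.
exists f; split; first by apply: he0; have := hf 0%N; rewrite /=; lra.
by move=> n _; have [_ _ _ _] := hz n; apply; exact: (hf n.+1).
Qed.

End baire.

(** * The stationary measure *)

Section stationary_measure.
Context {R : realType}.
Implicit Types (f : RDS R) (x y t : R).

(** The extension by 0 and 1 gives a cumulative function on R, as the Lebesgue-Stieltjes
    construction requires. *)
Definition cdf01 f x : R := if x <= 0 then 0 else if 1 <= x then 1 else scdf f (hlog x).

Lemma cdf01_in f x : 0 < x < 1 -> cdf01 f x = scdf f (hlog x).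
Proof. by move=> /andP[x0 x1]; rewrite /cdf01 leNgt x0/= leNgt x1. Qed.

Lemma cdf01_hexp f t : cdf01 f (hexp t) = scdf f t.
Proof. by rewrite cdf01_in ?hexp_in01// hexpK. Qed.

Lemma cdf01_le0 f x : x <= 0 -> cdf01 f x = 0.
Proof. by rewrite /cdf01 => ->. Qed.

Lemma cdf01_ge1 f x : 1 <= x -> cdf01 f x = 1.
Proof. by move=> x1; rewrite /cdf01 x1 leNgt (lt_le_trans ltr01 x1). Qed.

Lemma cdf01_nd f : nondecreasing (cdf01 f).
Proof.
move=> x y xy; have [x0|x0] := leP x 0.
  rewrite cdf01_le0//; have [y0|y0] := leP y 0; first by rewrite cdf01_le0.
  have [y1|y1] := leP 1 y; first by rewrite cdf01_ge1.
  by rewrite cdf01_in ?y0//; have /andP[] := scdf01 f (hlog y).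
have [y1|y1] := leP 1 y.
  rewrite (cdf01_ge1 _ y1); have [x1|x1] := leP 1 x; first by rewrite cdf01_ge1.
  by rewrite cdf01_in ?x0//; have /andP[] := scdf01 f (hlog x).
rewrite !cdf01_in; [|lra|lra].
by apply/scdf_le/hlog_le; lra.
Qed.

Lemma cdf01_right f x (e : R) : 0 < e -> exists2 y, x < y & cdf01 f y <= cdf01 f x + e.
Proof.
move=> e0; have [x0|x0] := ltP x 0.
  by exists 0 => //; rewrite (cdf01_le0 _ (lexx 0)) (cdf01_le0 _ (ltW x0)); lra.
move: x0; rewrite le_eqVlt => /predU1P[<-|x0].
  have [K hK] := scdf_low f e0; exists (hexp K).
    by have /andP[] := hexp_in01 K.
  by rewrite cdf01_hexp (cdf01_le0 _ (lexx _)) add0r hK.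
have [x1|x1] := leP 1 x.
  by exists (x + 1); rewrite ?cdf01_ge1//; lra.
have x01 : 0 < x < 1 by rewrite x0.
have /cvgrPdist_le/(_ e e0)[d /= d0 hd] := @scdf_continuous_snd R f (hlog x).
exists (hexp (hlog x + d / 2)).
  by rewrite -[ltLHS]hlogK// hexp_lt ltrDl divr_gt0.
rewrite cdf01_hexp cdf01_in//.
have := hd (hlog x + d / 2); rewrite /= opprD addNKr normrN gtr0_norm; last lra.
by rewrite ler_distl => h; have := h ltac:(lra); lra.
Qed.

Lemma cdf01_rc f : right_continuous (cdf01 f).
Proof.
move=> x; apply/cvgrPdist_le => e e0; have [y xy hy] := cdf01_right f x e0.
near=> z; have xz : x <= z by near: z; exact: nbhs_right_ge.
have zy : z <= y by near: z; exact: nbhs_right_le.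
have := cdf01_nd f xz; have := cdf01_nd f zy.
by rewrite ler_distl; lra.
Unshelve. all: by end_near. Qed.

Lemma cdf01_Ny f : cdf01 f @ -oo --> (0 : R).
Proof.
apply/cvgrPdist_le => e e0; near=> x.
rewrite cdf01_le0 ?subrr ?normr0 ?ltW//.
Unshelve. all: by end_near. Qed.

Lemma cdf01_y f : cdf01 f @ +oo --> (1 : R).
Proof.
apply/cvgrPdist_le => e e0; near=> x.
rewrite cdf01_ge1 ?subrr ?normr0 ?ltW//.
Unshelve. all: by end_near. Qed.

HB.instance Definition _ f := isCumulative.Build R _ R (cdf01 f) (@cdf01_nd f) (@cdf01_rc f).
HB.instance Definition _ f :=
  isCumulativeBounded.Build R 0 1 (cdf01 f) (@cdf01_Ny f) (@cdf01_y f).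

Definition smeas f : probability (measurableTypeR R) R :=
  lebesgue_stieltjes_measure (cdf01 f).

Lemma smeas_itv f x y : x <= y -> smeas f `]x, y]%classic = (cdf01 f y - cdf01 f x)%:E.
Proof.
move=> xy; rewrite /smeas /= /lebesgue_stieltjes_measure /measure_extension.
rewrite measurable_mu_extE/=; last exact: is_ocitv.
by rewrite wlength_itv_bnd.
Qed.

Lemma smeas_unique f (nu : {measure set (measurableTypeR R) -> \bar R}) :
  (forall x y, x < y -> nu `]x, y]%classic = (cdf01 f y - cdf01 f x)%:E) ->
  forall A : set (measurableTypeR R), measurable A -> nu A = smeas f A.
Proof.
move=> h A mA; apply/esym; apply: lebesgue_stieltjes_measure_unique => // X.
move=> /ocitvP[->|[z zlt ->]]; first by rewrite !measure0.
by rewrite h// -smeas_itv// ltW.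
Qed.

Lemma measurable_incr (c : R -> R) : incr_onto c ->
  measurable_fun [set: measurableTypeR R] (c : measurableTypeR R -> measurableTypeR R).
Proof. by move=> h; apply: continuous_measurable_fun; exact: incr_onto_continuous. Qed.

Lemma preimage_itv (c : R -> R) x y : incr_onto c ->
  c @^-1` `]x, y] = `]rinv c x, rinv c y]%classic.
Proof.
move=> h; apply/seteqP; split=> z /=; rewrite !in_itv/=.
  by rewrite -{1}(rinvK h x) -{1}(rinvK h y) (incr_onto_lt h) (incr_onto_le h).
by rewrite -{2}(rinvK h x) -{2}(rinvK h y) (incr_onto_lt h) (incr_onto_le h).
Qed.

Lemma rdsf_incr f j : incr_onto (rdsf f j).
Proof. exact/CI_incr/rdsf_homeo. Qed.

Lemma rdsf_inv_hexp f j t : rinv (rdsf f j) (hexp t) = hexp (G f j t).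
Proof.
have h := rdsf_incr f j; apply: (incr_onto_inj h); rewrite rinvK//.
by rewrite -[in LHS](GK f j t) /L /lift_of hlogK// CI_in01// hexp_in01.
Qed.

Lemma rdsf_inv_le0 f j x : x <= 0 -> rinv (rdsf f j) x <= 0.
Proof.
have h := incr_onto_rinv (rdsf_incr f j).
move=> x0; rewrite -(Krinv (rdsf_incr f j) 0) (incr_onto_le h).
by rewrite CI_at0.
Qed.

Lemma rdsf_inv_ge1 f j x : 1 <= x -> 1 <= rinv (rdsf f j) x.
Proof.
have h := incr_onto_rinv (rdsf_incr f j).
move=> x1; rewrite -(Krinv (rdsf_incr f j) 1) (incr_onto_le h).
by rewrite CI_at1.
Qed.

Lemma cdf01_fixed f x : cdf01 f x = rdsp f * cdf01 f (rinv (rdsf f false) x) +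
  (1 - rdsp f) * cdf01 f (rinv (rdsf f true) x).
Proof.
have [x0|x0] := leP x 0.
  by rewrite !cdf01_le0 ?rdsf_inv_le0// !mulr0 addr0.
have [x1|x1] := leP 1 x; first by rewrite !cdf01_ge1 ?rdsf_inv_ge1//; lra.
have -> : x = hexp (hlog x) by rewrite hlogK// x0.
by rewrite !rdsf_inv_hexp !cdf01_hexp -[LHS]scdf_fixed.
Qed.

(** The right side of the equation is a measure in A, a weighted sum of two push-forwards. It is
    enough to compare it with [smeas] on the intervals ]x, y], where [cdf01_fixed] applies. *)
Lemma smeas_stationary f : stationary f (smeas f).
Proof.
move=> A mA _.
have p01 := rdsp_in01 f.
have p0 : 0 <= rdsp f by lra.
have q0 : 0 <= 1 - rdsp f by lra.
have m0 := measurable_incr (rdsf_incr f false).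
have m1 := measurable_incr (rdsf_incr f true).
pose nu0 : {measure set (measurableTypeR R) -> \bar R} :=
  mscale (NngNum p0) (pushforward (smeas f) (rdsf f false : measurableTypeR R -> measurableTypeR R)).
pose nu1 : {measure set (measurableTypeR R) -> \bar R} :=
  mscale (NngNum q0) (pushforward (smeas f) (rdsf f true : measurableTypeR R -> measurableTypeR R)).
have E B : measure_add (nu0 m0) (nu1 m1) B = ((rdsp f)%:E * smeas f (rds0 f @^-1` B) +
            (1 - rdsp f)%:E * smeas f (rds1 f @^-1` B))%E by rewrite measure_addE.
rewrite -E; apply/esym; apply: smeas_unique => // x y xy; apply: (eq_trans (E _)).
rewrite (preimage_itv _ _ (rdsf_incr f false)) (preimage_itv _ _ (rdsf_incr f true)).
have le j : rinv (rdsf f j) x <= rinv (rdsf f j) y.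
  by rewrite (incr_onto_le (incr_onto_rinv (rdsf_incr f j))) ltW.
rewrite !smeas_itv// -!EFinM -EFinD; congr (_%:E).
by rewrite (cdf01_fixed f x) (cdf01_fixed f y); lra.
Qed.

Lemma scdf_near1 f (e : R) : 0 < e -> exists t, 1 - e <= scdf f t.
Proof.
move=> e0; have [K hK] := scdf_high f e0; exists (- K).
by have := hK K (lexx K); lra.
Qed.

Lemma smeas_on01 f : on01 (smeas f).
Proof.
rewrite /on01; apply/le_anti/andP; split; first exact: probability_le1.
apply/lee_addgt0Pr => e e0; have [t ht] := scdf_near1 f e0.
have /andP[h0 h1] := hexp_in01 t.
pose S : set (measurableTypeR R) := `]0, hexp t]%classic.
pose S1 : set (measurableTypeR R) := `]0, 1[%classic.
have sub : (smeas f S <= smeas f S1)%E.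
  apply: le_measure; rewrite ?inE//; try exact: measurable_itv.
  by move=> z; rewrite /S /S1 /= !in_itv/= => /andP[-> /le_lt_trans]; exact.
apply: (@le_trans _ _ (smeas f S + e%:E)%E); last exact: leeD2r.
rewrite smeas_itv ?(ltW h0)// cdf01_hexp cdf01_le0// -EFinD lee_fin; lra.
Qed.

Section uniqueness.
Variables (f : RDS R) (nu : probability (measurableTypeR R) R).
Hypotheses (nu01 : on01 nu) (nu_stat : stationary f nu).

Let fin (A : set (measurableTypeR R)) : measurable A -> nu A \is a fin_num.
Proof. by move=> mA; exact: fin_num_measure. Qed.

Let H t := fine (nu `]0, hexp t]%classic).

Let nuH t : nu `]0, hexp t]%classic = (H t)%:E.
Proof. by rewrite /H fineK// fin. Qed.

Let nuU (A B : set (measurableTypeR R)) : measurable A -> measurable B ->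
  A `&` B = set0 -> nu (A `|` B) = (nu A + nu B)%E.
Proof. by move=> mA mB AB; exact: measureU. Qed.

Let nu_out (A : set (measurableTypeR R)) : measurable A ->
  A `&` `]0, 1[%classic = set0 -> nu A = 0%E.
Proof.
move=> mA A0; apply/le_anti/andP; split; last exact: measure_ge0.
pose S : set (measurableTypeR R) := `]0, 1[%classic.
have mS : measurable S by exact: measurable_itv.
have nuS : nu S = 1%E by exact: nu01.
have : (nu (A `|` S) <= 1)%E by exact/probability_le1/measurableU.
rewrite (nuU mA mS A0) nuS -(fineK (fin mA)) -EFinD !lee_fin; lra.
Qed.

Let decreasing_small (E : nat -> set (measurableTypeR R)) (e : R) :
  (forall n, measurable (E n)) -> nonincreasing_seq E -> \bigcap_n E n = set0 ->
  0 < e -> exists n, fine (nu (E n)) <= e.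
Proof.
move=> mE dE E0 e0.
have := @nonincreasing_cvg_mu _ _ _ nu E _ mE _ dE.
rewrite E0 measure0 => /(_ _ _)/fine_cvg cv.
have {cv} : fine (nu (E n)) @[n --> \oo] --> (0 : R).
  apply: cv => //; first by rewrite ltey_eq fin.
move=> /cvgrPdist_le/(_ e e0)[n _ /(_ n (leqnn n))] /=.
rewrite sub0r normrN => h; exists n; exact: le_trans (ler_norm _) h.
Qed.

(** The preimage of ]0, hexp t] under f_j is ]0, hexp (G_j t)], so stationarity gives T H = H; the
    limits at the ends come from continuity of nu along decreasing intervals with empty
    intersection. *)
Let H_cdf : is_cdf f H.
Proof.
have mitv (a b : R) : measurable (`]a, b]%classic : set (measurableTypeR R)).
  exact: measurable_itv.
split.
- move=> s t st; apply: fine_le; rewrite ?fin//.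
  apply: le_measure; rewrite ?inE// => z /=; rewrite !in_itv/= => /andP[->/=].
  by move=> /le_trans; apply; rewrite hexp_le.
- move=> t; rewrite -2!lee_fin -nuH measure_ge0/=.
  exact: probability_le1.
- move=> t; apply: EFin_inj; rewrite -nuH nu_stat//; last first.
    move=> z /=; rewrite !in_itv/= => /andP[-> zt] /=.
    by apply: le_lt_trans zt _; have /andP[] := hexp_in01 t.
  have pre j : rdsf f j @^-1` `]0, hexp t] = `]0, hexp (G f j t)]%classic.
    rewrite (preimage_itv _ _ (rdsf_incr f j)) rdsf_inv_hexp.
    by rewrite -[in LHS](@CI_at0 R (rdsf f j)) Krinv//; exact: rdsf_incr.
  have pre0 : rds0 f @^-1` `]0, hexp t] = `]0, hexp (G f false t)]%classic := pre false.
  have pre1 : rds1 f @^-1` `]0, hexp t] = `]0, hexp (G f true t)]%classic := pre true.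
  have lincomb (x y z u : R) : (x%:E * y%:E + z%:E * u%:E)%E = (x * y + z * u)%:E.
    by rewrite -!EFinM -EFinD.
  rewrite pre0 pre1; apply/esym.
  apply: (eq_trans _ (lincomb _ (H (G f false t)) _ (H (G f true t)))).
  congr (_ * _ + _ * _)%E.
    exact: nuH.
  exact: nuH.
- move=> e e0; pose E (n : nat) : set (measurableTypeR R) := `]0, hexp (- n%:R)]%classic.
  have [||||n hn] := @decreasing_small E e.
  + by move=> n; exact: mitv.
  + move=> n m nm; apply/subsetPset => z; rewrite /E /= !in_itv/= => /andP[-> zt] /=.
    by apply: le_trans zt _; rewrite hexp_le lerN2 ler_nat.
  + apply/seteqP; split => // z zE.
    have z01 : 0 < z < 1.
      have := zE 0%N I; rewrite /E /= in_itv/= oppr0 hexp0; lra.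
    have := zE (Num.truncn `|hlog z|).+1 I; rewrite /E /= in_itv/= => /andP[_].
    rewrite -[z in X in (X <= _) -> _]hlogK// hexp_le.
    have /andP[_] := truncn_itv (normr_ge0 (hlog z)).
    by have := ler_norm (- hlog z); rewrite normrN; lra.
  + exact: e0.
  exists (- n%:R) => t tn; apply: le_trans hn; apply: fine_le; rewrite ?fin//; try exact: mitv.
  apply: le_measure; rewrite ?inE//; try exact: mitv.
  move=> z; rewrite /E /= !in_itv/= => /andP[-> zt] /=.
  by apply: le_trans zt _; rewrite hexp_le.
- move=> e e0; pose E (n : nat) : set (measurableTypeR R) := `]hexp n%:R, 1[%classic.
  have mE n : measurable (E n) by exact: measurable_itv.
  have [||||n hn] := @decreasing_small E e.
  + exact: mE.
  + move=> n m nm; apply/subsetPset => z; rewrite /E /= !in_itv/= => /andP[zt ->].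
    by rewrite andbT; apply: le_lt_trans zt; rewrite hexp_le ler_nat.
  + apply/seteqP; split => // z zE.
    have z01 : 0 < z < 1.
      have := zE 0%N I; rewrite /E /= in_itv/= hexp0; lra.
    have := zE (Num.truncn `|hlog z|).+1 I; rewrite /E /= in_itv/= => /andP[+ _].
    rewrite -[z in X in (_ < X) -> _]hlogK// hexp_lt.
    have /andP[_] := truncn_itv (normr_ge0 (hlog z)).
    by have := ler_norm (hlog z); lra.
  + exact: e0.
  exists (- n%:R) => t tn.
  have nt : n%:R <= - t by lra.
  have : nu `]0, 1[%classic = nu (`]0, hexp (- t)]%classic `|` `]hexp (- t), 1[%classic).
    congr (nu _); apply/seteqP; split=> z /=; rewrite !in_itv/=.
      by move=> /andP[-> ->]; rewrite andbT; case: (leP z (hexp (- t))) => _; [left|right].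
    have /andP[h0 h1] := hexp_in01 (- t).
    by case=> /andP[a b]; lra.
  rewrite nu01 nuU//; try exact: measurable_itv; last first.
    by apply/seteqP; split => // z /=; rewrite !in_itv/= => -[/andP[_ a] /andP[b _]]; lra.
  pose S : set (measurableTypeR R) := `]hexp (- t), 1[%classic.
  have sub : (nu S <= nu (E n))%E.
    apply: le_measure; rewrite ?inE//; try exact: measurable_itv.
    move=> z; rewrite /S /E /= !in_itv/= => /andP[zt ->]; rewrite andbT.
    by apply: le_lt_trans zt; rewrite hexp_le.
  have fE := fin (mE n).
  have fI : nu S \is a fin_num by apply: fin; exact: measurable_itv.
  rewrite -/S; move: sub hn; rewrite nuH -(fineK fI) -(fineK fE) -EFinD lee_fin /= => sub hn [].
  by lra.
Qed.

(** By uniqueness of the fixed point H is [scdf f], so nu and [smeas f] have the same distribution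
    function. *)
Lemma stationary_unique (A : set (measurableTypeR R)) : measurable A -> nu A = smeas f A.
Proof.
have HE : H = scdf f by exact: scdfE.
have mitv (a b : R) : measurable (`]a, b]%classic : set (measurableTypeR R)).
  exact: measurable_itv.
have cdfE x : nu `]-oo, x]%classic = (cdf01 f x)%:E.
  have mx : measurable (`]-oo, x]%classic : set (measurableTypeR R)) by exact: measurable_itv.
  have m0 : measurable (`]-oo, 0]%classic : set (measurableTypeR R)) by exact: measurable_itv.
  have [x0|x0] := leP x 0.
    rewrite cdf01_le0// nu_out//.
    by apply/seteqP; split => // z /=; rewrite !in_itv/= => -[a /andP[b _]]; have := lt_le_trans b (le_trans a x0); rewrite ltxx.
  have [x1|x1] := leP 1 x.
    rewrite cdf01_ge1//; apply/le_anti; rewrite probability_le1//= -nu01.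
    apply: le_measure; rewrite ?inE//; try exact: measurable_itv.
    by move=> z /=; rewrite !in_itv/= => /andP[_ /ltW/le_trans]; exact.
  have -> : `]-oo, x]%classic = `]-oo, 0]%classic `|` `]0, x]%classic.
    apply/seteqP; split=> z /=; rewrite !in_itv/=.
      by move=> zx; case: (leP z 0) => ?; [left|right].
    by case => [z0|/andP[]//]; apply: le_trans z0 (ltW x0).
  rewrite nuU//; last first.
    by apply/seteqP; split => // z /=; rewrite !in_itv/= => -[a /andP[b _]]; have := lt_le_trans b a; rewrite ltxx.
  rewrite nu_out ?add0e//; last first.
    by apply/seteqP; split => // z /=; rewrite !in_itv/= => -[a /andP[b _]]; have := lt_le_trans b a; rewrite ltxx.
  have x01 : 0 < x < 1 by rewrite x0.
  by rewrite cdf01_in// -HE -nuH hlogK.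
move=> mA; apply: smeas_unique => // x y xy.
have mx : measurable (`]-oo, x]%classic : set (measurableTypeR R)) by exact: measurable_itv.
have : nu `]-oo, y]%classic = nu (`]-oo, x]%classic `|` `]x, y]%classic).
  congr (nu _); apply/seteqP; split=> z /=; rewrite !in_itv/=.
    by move=> zx; case: (leP z x) => ?; [left|right].
  by case => [z0|/andP[]//]; apply: le_trans z0 (ltW xy).
rewrite nuU//; last first.
  by apply/seteqP; split => // z /=; rewrite !in_itv/= => -[a /andP[b _]]; have := lt_le_trans b a; rewrite ltxx.
rewrite !cdfE -(fineK (fin (mitv x y))) -EFinD => -[] e.
apply: (eq_trans (esym (fineK (fin (mitv x y))))); congr (_%:E); lra.
Qed.

End uniqueness.

Lemma smeas_unique_stationary f : unique_stationary f (smeas f).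
Proof.
split; [exact: smeas_on01|exact: smeas_stationary|].
by move=> nu nu01 nust A mA; exact: stationary_unique.
Qed.

End stationary_measure.

(** * Genericity *)

Section genericity.
Context {R : realType}.
Implicit Types (f : RDS R).

Lemma smeas_full_support f :
  (forall a b : rat, a < b -> scdf f (ratr a) < scdf f (ratr b)) ->
  full_support01 (smeas f).
Proof.
move=> inc U oU [x Ux] U01.
have in01 z : U z -> 0 < z < 1 by move=> /U01; rewrite /= in_itv.
have [d /= d0 hd] : exists2 d : R, 0 < d & ball x d `<=` U.
  by move: oU; rewrite openE => /(_ x Ux)/nbhs_ballP[d ? ?]; exists d.
pose y := x + d / 2.
have inU z : x <= z <= y -> U z.
  by move=> xzy; apply: hd; move: xzy; rewrite /ball/= ltr_distlC /y; lra.
have xy : x < y by rewrite /y; lra.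
have xlt : hlog x < hlog y.
  by rewrite hlog_ltE ?in01//; apply: inU; rewrite lexx ltW.
have [a] := rat_in_itvoo xlt; rewrite in_itv/= => /andP[xa ay].
have [b] := rat_in_itvoo ay; rewrite in_itv/= => /andP[ab b_y].
pose S : set (measurableTypeR R) := `]hexp (ratr a), hexp (ratr b)]%classic.
have hx : hexp (hlog x) = x by rewrite hlogK ?in01.
have hy : hexp (hlog y) = y by rewrite hlogK ?in01//; apply: inU; rewrite lexx ltW.
have S_U : S `<=` U.
  move=> z; rewrite /S /= in_itv/= => /andP[az zb]; apply: inU.
  rewrite -hx -hy; apply/andP; split; first by apply/ltW/lt_trans/az; rewrite hexp_lt.
  by apply/ltW/(le_lt_trans zb); rewrite hexp_lt.
apply: (@lt_le_trans _ _ (smeas f S)).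
  rewrite smeas_itv ?hexp_le ?ltW// !cdf01_hexp lte_fin subr_gt0 inc//.
  by rewrite -(ltr_rat R).
apply: le_measure => //; rewrite inE; first exact: measurable_itv.
exact: open_measurable.
Qed.

(** The intervals are carried to (0,1) by [hexp], which does not increase lengths; being disjoint,
    their masses add up. *)
Lemma concentrated_set f (e : R) : concentrated f e ->
  exists A : set (measurableTypeR R), [/\ measurable A, A `<=` `]0, 1[%classic,
    ((1 - e)%:E <= smeas f A)%E & (lebesgue_measure A <= e%:E)%E].
Proof.
move=> [M [w [tau [w0 /andP[tau0 tau1] small big]]]].
pose I (i : nat) : set (measurableTypeR R) :=
  `]hexp (cell M w i), hexp (cell M w i + w * tau)]%classic.
have mI i : measurable (I i) by exact: measurable_itv.
have wt : 0 < w * tau by rewrite mulr_gt0.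
have wt1 : w * tau < w by rewrite -[ltRHS]mulr1 ltr_pM2l.
have disj i j : (i < j)%N -> I i `&` I j = set0.
  move=> ij; apply/seteqP; split=> // z; rewrite /I /= !in_itv/= => -[/andP[_ a] /andP[b _]].
  have := lt_le_trans b a; rewrite hexp_lt /cell => lt.
  have : (i.+1%:R - M%:R) * w <= (j%:R - M%:R) * w.
    by rewrite ler_pM2r// lerD2r ler_nat.
  by rewrite -natr1; lra.
have tI : trivIset [set: 'I_(M.*2)] (fun i => I i).
  apply/trivIsetP => i j _ _; rewrite -val_eqE neq_ltn => /orP[/disj//|/disj].
  by rewrite setIC.
have mI' (i : 'I_(M.*2)) : measurable (I i) by exact: mI.
have lebI i : (lebesgue_measure (I i) <= (w * tau)%:E)%E.
  rewrite lebesgue_measure_itv/= lte_fin hexp_lt ltrDl wt.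
  rewrite -EFinB lee_fin; apply: le_trans (hexpB_le _) _; first by rewrite lerDl ltW.
  by rewrite addrAC subrr add0r.
exists (\big[setU/set0]_(i < M.*2) I i); split.
- exact: bigsetU_measurable.
- elim/big_ind: _ => [//|B C hB hC z [/hB|/hC]//|i _ z].
  rewrite /I /= !in_itv/= => /andP[a b].
  have /andP[a0 _] := hexp_in01 (cell M w i).
  have /andP[_ b1] := hexp_in01 (cell M w i + w * tau).
  by rewrite (lt_trans a0 a) (le_lt_trans b b1).
- rewrite (measure_bigsetU_ord _ xpredT mI' tI).
  have -> : \sum_(i < M.*2) smeas f (I i) =
      (\sum_(i < M.*2) (scdf f (cell M w i + w * tau) - scdf f (cell M w i)))%:E.
    rewrite -sumEFin; apply: eq_bigr => i _.
    by rewrite smeas_itv ?hexp_le ?lerDl ?ltW// !cdf01_hexp.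
  by rewrite lee_fin ltW.
- rewrite (measure_bigsetU_ord _ xpredT mI' tI).
  apply: (@le_trans _ _ (\sum_(i < M.*2) (w * tau)%:E)%E).
    by apply: lee_sum => i _; exact: lebI.
  by rewrite sumEFin sumr_const card_ord -mulr_natl lee_fin ltW.
Qed.

(** Borel-Cantelli: the upper limit of the sets A n is Lebesgue null because the bounds 1 / 2^(n+1)
    are summable, and has full mass because every tail union contains sets of mass arbitrarily near
    1. *)
Lemma smeas_singular f : (forall n, concentrated f (1 / (2 ^ n.+1)%:R)) ->
  singular01 (smeas f).
Proof.
move=> con; have /choice[A hA] := fun n => concentrated_set (con n).
have mA n : measurable (A n) by have [] := hA n.
have mU n : measurable (\bigcup_(k >= n) A k) by exact: bigcup_measurable.
have mL : measurable (lim_sup_set A) by apply: bigcap_measurable.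
exists (lim_sup_set A); split => //.
- move=> z /(_ 0%N I)[k _ Ak]; have [_ + _ _] := hA k; exact.
- have cv := lim_sup_set_cvg (smeas f) A mA.
  have one n : smeas f (\bigcup_(k >= n) A k) = 1%E.
    apply/le_anti; rewrite probability_le1//=.
    apply/lee_addgt0Pr => e e0.
    (* m is at least n, to stay in the tail union, and large enough for 1 / 2^(m+1) <= e. *)
    pose m := maxn n (Num.truncn e^-1).
    have em : 1 / (2 ^ m.+1)%:R <= e.
      have m2 : 0 < (2 ^ m.+1)%:R :> R by rewrite ltr0n expn_gt0.
      rewrite ler_pdivrMr// -ler_pdivrMl// mulr1.
      have /andP[_ /ltW h] := truncn_itv (ltW (ltac:(by rewrite invr_gt0) : 0 < e^-1)).
      apply: (le_trans h); rewrite ler_nat.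
      apply: leq_trans (ltnW (ltn_expl m.+1 (ltnSn 1))).
      by rewrite ltnS leq_maxr.
    have [_ _ h _] := hA m.
    apply: (@le_trans _ _ (smeas f (A m) + e%:E)%E).
      apply: le_trans (leeD2r e%:E h); rewrite -EFinD lee_fin; lra.
    apply: leeD2r; apply: le_measure; rewrite ?inE//.
    by move=> z Az; exists m => //=; rewrite leq_maxl.
  have {}cv : (fun n => smeas f (\bigcup_(k >= n) A k)) @ \oo --> smeas f (lim_sup_set A).
    apply: cv; exact: (le_lt_trans (probability_le1 (smeas f) (mU 0%N)) (ltry _)).
  have : (fun n => smeas f (\bigcup_(k >= n) A k)) @ \oo --> 1%E.
    have -> : (fun n => smeas f (\bigcup_(k >= n) A k)) = (fun=> 1%E); [exact/funext|exact: cvg_cst].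
  by move/(cvg_unique _ cv); exact.
- apply: (@lim_sup_set_cvg0 _ _ _ (@lebesgue_measure R) A mA).
  apply: (@le_lt_trans _ _ 1%E); last exact: ltry.
  apply: le_trans (@epsilon_trick0 R 1 xpredT ler01).
  by apply: lee_nneseries => n _ //; have [] := hA n.
Qed.

Lemma dense_dm (S : set (RDS R)) :
  (forall f (e : R), 0 < e -> exists2 h, dm f h < e & S h) -> dense S.
Proof.
move=> h O [f Of] oO; have [e e0 he] := open_dm oO Of.
by have [g fg Sg] := h f e e0; exists g; split => //; exact: he.
Qed.

Lemma generic_residual : residual [set f : RDS R |
  exists mu : probability (measurableTypeR R) R,
    [/\ unique_stationary f mu, singular01 mu & full_support01 mu]].
Proof.
pose P (n : nat) : set (RDS R) := [set f | concentrated f (1 / (2 ^ n.+1)%:R)].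
(* Codes that are not pairs a < b give the whole space, so that every Q n is open and dense. *)
pose Q (n : nat) : set (RDS R) := if unpickle n is Some (a, b) then
  if (a : rat) < b then [set f | scdf f (ratr a) < scdf f (ratr b)] else setT else setT.
have oP n : open (P n) by exact: concentrated_open.
have dP n : dense (P n).
  have en : 0 < 1 / (2 ^ n.+1)%:R :> R by rewrite divr_gt0// ltr0n expn_gt0.
  by apply: dense_dm => f e e0; exact: concentrated_dense.
have dT : dense [set: RDS R] by move=> O [f Of] _; exists f.
have oQ n : open (Q n).
  rewrite /Q; case: (unpickle n) => [[a b]|]; last exact: openT.
  by case: ifP => _; [exact: scdf_lt_open|exact: openT].
have dQ n : dense (Q n).
  rewrite /Q; case: (unpickle n) => [[a b]|//]; case: ifPn => // ab.
  apply: dense_dm => f e e0.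
  by have [|h fh hh] := @full_support_dense R f (ratr a) (ratr b) e _ e0; [rewrite ltr_rat|exists h].
exists (\bigcap_n (P n `&` Q n)); split.
- by exists (fun n => P n `&` Q n) => // n; exact: openI.
- by apply: RDS_baire => n; split; [exact: openI|exact: denseI].
- move=> f hf; exists (smeas f); split.
  + exact: smeas_unique_stationary.
  + by apply: smeas_singular => n; have [] := hf n I.
  + apply: smeas_full_support => a b ab.
    by have [_] := hf (pickle (a, b)) I; rewrite /Q pickleK ab.
Qed.

End genericity.

Theorem theorem6p2 (R : realType) :
  baire_space (RDS R) /\
  residual [set f : RDS R |
    exists mu : probability (measurableTypeR R) R,
      [/\ unique_stationary f mu, singular01 mu & full_support01 mu]].
Proof. by split; [exact: RDS_baire|exact: generic_residual]. Qed.
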